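(* Let $A=(a_{ij})_{i,j\in I}$ be a generalized Cartan matrix and let $\mathcal{A}_0$ be a Poisson algebra without zerodivisors which is generated, as a Poisson algebra, by a set of nonzero elements $(\varphi_i)_{i\in I}$ such that $\mathrm{ad}_{\{\}}(\varphi_i)^{-a_{ij}+1}(\varphi_j)=0$ for all $i\neq j$. Let $\mathcal{K}=Q(\mathcal{A}_0[\lambda])$ and let $s_i=\exp\big(\frac{\lambda_i}{\varphi_i}\mathrm{ad}_{\{\}}(\varphi_i)\big)\circ r_i$ $(i\in I)$ be the associated automorphisms of $\mathcal{K}$. Let $\mathcal{K}[\tau^{\pm1}]=\mathcal{K}[\tau_i^{\pm1}\,(i\in I)]$ be the ring of Laurent polynomials in indeterminates $\tau_i$ $(i\in I)$ over $\mathcal{K}$. Extend the automorphisms $s_i$ of $\mathcal{K}$ to automorphisms of $\mathcal{K}[\tau^{\pm1}]$ by $$s_i(\tau_j)=\tau_j\quad(i\neq j),\qquad s_i(\tau_i)=\varphi_i\,\tau_i\prod_{k\in I}\tau_k^{-a_{ki}} .$$ Then these $s_i$ $(i\in I)$ again give a realization of the Weyl group $W(A)$ as a group of automorphisms of $\mathcal{K}[\tau^{\pm1}]$; that is, they satisfy on $\mathcal{K}[\tau^{\pm1}]$ the defining relations $s_i^2=1$ and $(s_is_j)^{m_{ij}}=1$ $(i\neq j)$ of $W(A)$.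
   Context: A generalized Cartan matrix (GCM) is an integer matrix $A=(a_{ij})_{i,j\in I}$ with $a_{jj}=2$, $a_{ij}\le 0$ for $i\ne j$, and $a_{ij}=0\iff a_{ji}=0$. If $I$ is infinite, $A$ is always assumed locally finite: for any $i\in I$, $a_{ij}=0$ except for finitely many $j$. The Weyl group $W(A)$ is the group with generators $r_i$ $(i\in I)$ and relations $r_i^2=1$, $(r_ir_j)^{m_{ij}}=1$ $(i\neq j)$, with $m_{ij}=2,3,4,6,\infty$ according as $a_{ij}a_{ji}=0,1,2,3,\ge4$ (no relation when $m_{ij}=\infty$). A Poisson algebra is a commutative $\mathbb{C}$-algebra with a skew-symmetric bilinear bracket $\{\,,\,\}$ which is a derivation in each argument and satisfies the Jacobi identity. $\mathrm{ad}_{\{\}}(f)=\{f,\cdot\}$. $\mathcal{A}_0[\lambda]$ is the polynomial ring over $\mathcal{A}_0$ in indeterminates $\lambda_i$ $(i\in I)$ and $Q(\cdot)$ denotes the field of fractions. The Poisson bracket extends to $\mathcal{K}$ with all $\lambda_i$ central ($\{\lambda_i,\cdot\}=0$). $r_i$ denotes the $\mathcal{A}_0$-linear automorphism with $r_i(\lambda_j)=\lambda_j-a_{ji}\lambda_i$ $(j\in I)$. Since $\mathrm{ad}_{\{\}}(\varphi_i)$ is locally nilpotent on $\mathcal{A}_0$, for $\psi\in\mathcal{A}_0$ one has the finite sum $s_i(\psi)=\sum_{k\ge0}\frac1{k!}\big(\frac{\lambda_i}{\varphi_i}\big)^k\mathrm{ad}_{\{\}}(\varphi_i)^k(\psi)$,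 and $s_i(\lambda_j)=\lambda_j-a_{ji}\lambda_i$; this determines an automorphism $s_i$ of $\mathcal{K}$. *)

(* Defs.v *)
From HB Require Import structures.
From mathcomp Require Import all_boot all_order all_algebra finmap.
From mathcomp Require Import boolp classical_sets cardinality fsbigop reals.
From mathcomp Require Import complex monalg.

Set Implicit Arguments.
Unset Strict Implicit.
Unset Printing Implicit Defensive.

Import Order.TTheory GRing.Theory Num.Theory.
Local Open Scope ring_scope.

(* Poisson algebras over a commutative ring k (associative, commutative and
   unital). *)
HB.mixin Record ComAlgebra_isPoisson (k : comNzRingType) A
    of GRing.ComAlgebra k A := {
  bracket : A -> A -> A;
  bracket_linearl : forall g, linear (fun f => bracket f g);
  bracket_linearr : forall f, linear (bracket f);
  bracketC : forall f g, bracket f g = - bracket g f;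
  bracketMl : forall f g h,
    bracket (f * g) h = f * bracket g h + bracket f h * g;
  bracketMr : forall f g h,
    bracket f (g * h) = bracket f g * h + g * bracket f h;
  bracket_jacobi : forall f g h,
    bracket f (bracket g h) + bracket g (bracket h f)
      + bracket h (bracket f g) = 0
}.

#[short(type="poissonAlgType")]
HB.structure Definition PoissonAlgebra (k : comNzRingType) :=
  {A of GRing.ComAlgebra k A & ComAlgebra_isPoisson k A}.

#[short(type="poissonDomainType")]
HB.structure Definition PoissonDomain (k : comNzRingType) :=
  {A of PoissonAlgebra k A & GRing.IntegralDomain A}.

Definition poisson_generated (k : comNzRingType) (A : poissonAlgType k)
    (I : Type) (phi : I -> A) : Prop :=
  forall S : {pred A},
    GRing.subalg_closed S ->
    (forall f g, f \in S -> g \in S -> bracket f g \in S) ->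
    (forall i, phi i \in S) ->
  forall f, f \in S.

Definition is_gcm (I : choiceType) (a : I -> I -> int) : Prop :=
  [/\ forall i, a i i = 2,
      forall i j, i != j -> a i j <= 0,
      forall i j, a i j = 0 <-> a j i = 0
    & forall i, finite_set [set j | a i j != 0]%classic].

(* None stands for m_ij = oo.  For a generalized Cartan matrix the product
   a_ij a_ji is nonnegative when i != j. *)
Definition coxeter_exponent (I : Type) (a : I -> I -> int) (i j : I) :
    option nat :=
  match a i j * a j i with
  | Posz 0 => Some 2%N
  | Posz 1 => Some 3%N
  | Posz 2 => Some 4%N
  | Posz 3 => Some 6%N
  | _ => None
  end.

Definition weyl_relations (I : eqType) (a : I -> I -> int) (T : Type)
    (s : I -> T -> T) : Prop :=
  (forall i, s i \o s i =1 id) /\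
  (forall i j, i != j -> forall m, coxeter_exponent a i j = Some m ->
     iter m (s i \o s j) =1 id).

(* Any commutative ring has a (classical) inverse operation. *)
Section ClassicalUnit.
Variable R : comNzRingType.

Definition cunit : {pred R} := fun x => `[< exists y, y * x = 1 >].

Definition cinv (x : R) : R :=
  if pselect (exists y, y * x = 1) is left e then sval (cid e) else x.

Lemma cmulVr : {in cunit, left_inverse 1 cinv *%R}.
Proof.
by move=> x /asboolP ux; rewrite /cinv; case: pselect => // e; case: (cid e).
Qed.

Lemma cunitP (x y : R) : y * x = 1 -> cunit x.
Proof. by move=> yx; apply/asboolP; exists y. Qed.

Lemma cinv_out : {in [predC cunit], cinv =1 id}.
Proof.
move=> x; rewrite inE /= => nux; rewrite /cinv; case: pselect => // e.
by case/negP: nux; apply/asboolP.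
Qed.
End ClassicalUnit.

(* {malg R[{cmonom I}]}, the polynomial ring over R in the indeterminates
   <<U_(i)>> (i : I), has no zero divisors: by Kronecker's substitution
   x_i := X ^ (B ^ k_i), two given polynomials are mapped injectively enough
   into {poly R}. *)
Section Kronecker.
Variables (R : idomainType) (I : choiceType).
Implicit Types (m : {cmonom I}) (p q : {malg R[{cmonom I}]}).

Fixpoint kwt (B : nat) (s : seq I) m : nat :=
  if s is i :: s' then (m i + B * kwt B s' m)%N else 0%N.

Lemma malgUM (m1 m2 : {cmonom I}) :
  << mmul m1 m2 >> = << m1 >> * << m2 >> :> {malg R[{cmonom I}]}.
Proof. by rewrite malgM_def fgmulUU mulr1. Qed.

Lemma kwt1 B s : kwt B s mone = 0%N.
Proof. by elim: s => //= i s ->; rewrite cm1 muln0. Qed.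

Lemma kwtM B s m1 m2 : kwt B s (mmul m1 m2) = (kwt B s m1 + kwt B s m2)%N.
Proof. by elim: s => //= i s ->; rewrite cmM mulnDr addnACA. Qed.

Lemma kwt_inj B s m1 m2 :
    (forall i, m1 i < B)%N -> (forall i, m2 i < B)%N ->
  kwt B s m1 = kwt B s m2 -> {in s, m1 =1 m2}.
Proof.
move=> b1 b2; have B_gt0 (i : I) : (0 < B)%N by apply: leq_ltn_trans (b1 i).
elim: s => //= i s IHs e; have Bp := B_gt0 i.
have em : m1 i = m2 i.
  have E x c : (x < B)%N -> ((x + B * c) %% B)%N = x.
    by move=> xB; rewrite addnC mulnC modnMDl modn_small.
  by rewrite -(E _ (kwt B s m1) (b1 i)) e E.
move: e; rewrite em => /addnI /eqP; rewrite eqn_pmul2l // => /eqP /IHs ih.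
by move=> j; rewrite inE => /orP[/eqP->//|/ih].
Qed.

Definition kmon B s m : {poly R} := 'X^(kwt B s m).

Lemma kmon_morph B s : mmorphism (kmon B s).
Proof.
by split=> [m1 m2|]; rewrite /kmon ?kwt1 ?expr0 // kwtM exprD.
Qed.

HB.instance Definition _ B s :=
  isMultiplicative.Build {cmonom I} {poly R} (kmon B s) (kmon_morph B s).

Definition kron B s : {rmorphism {malg R[{cmonom I}]} -> {poly R}} :=
  mmap (@polyC R) (kmon B s).

Lemma kron_eq0 B s p :
    (forall m i, m \in msupp p -> m i < B)%N ->
    (forall m i, m \in msupp p -> i \in finsupp m -> i \in s) ->
  kron B s p = 0 -> p = 0.
Proof.
move=> bB bs p0; apply/malgP => m; rewrite mcoeff0; apply/eqP.
rewrite -[_ == 0]negbK mcoeff_neq0; apply/negP => mp.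
move: p0 => /(congr1 (fun r : {poly R} => r`_(kwt B s m))).
rewrite /= mmapE coef0 coef_sum (big_fsetD1 m) //= coefCM coefXn eqxx mulr1.
rewrite big_seq big1 ?addr0 => [/eqP|m' ].
  by rewrite mcoeff_eq0 mp.
rewrite in_fsetD1 => /andP[nm m'p]; rewrite coefCM coefXn.
case: eqP; rewrite ?mulr0 // => e; case/negP: nm; apply/cmP => i.
have e' := kwt_inj (fun i => bB m i mp) (fun i => bB m' i m'p) e.
have [iS|iS] := boolP (i \in s); first by rewrite e'.
have z m'' : m'' \in msupp p -> m'' i = 0%N.
  by move=> m''p; apply/eqP; rewrite cmE_eq0; apply: contra iS; apply: bs.
by rewrite !z.
Qed.

Definition kvars p : seq I :=
  flatten [seq (finsupp m : seq I) | m <- (msupp p : seq _)].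

Lemma kvarsP p m i : m \in msupp p -> i \in finsupp m -> i \in kvars p.
Proof. by move=> mp im; apply/flatten_mapP; exists m. Qed.

Definition kbound p : nat :=
  \sum_(m <- (msupp p : seq {cmonom I})) \sum_(i <- (kvars p)) m i.

Lemma kboundP p m i : m \in msupp p -> (m i <= kbound p)%N.
Proof.
move=> mp; case: (mdomP m i) => // im; have iv := kvarsP mp im.
rewrite /kbound (big_rem m) //= (big_rem i) //= -addnA; exact: leq_addr.
Qed.

Lemma malg_mulf_eq0 p q : p * q = 0 -> (p == 0) || (q == 0).
Proof.
move=> pq; pose B := (kbound p + kbound q).+1; pose s := kvars p ++ kvars q.
have /eqP : kron B s (p * q) = 0 by rewrite pq rmorph0.
rewrite rmorphM mulf_eq0 => /orP[] /eqP k0; apply/orP; [left|right];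
  apply/eqP; move: k0; apply: kron_eq0 => m i mp.
- by rewrite ltnS; apply: leq_trans (kboundP i mp) (leq_addr _ _).
- by move=> im; rewrite mem_cat (kvarsP mp im).
- by rewrite ltnS; apply: leq_trans (kboundP i mp) (leq_addl _ _).
- by move=> im; rewrite mem_cat (kvarsP mp im) orbT.
Qed.
End Kronecker.

HB.instance Definition _ (R : idomainType) (I : choiceType) :=
  GRing.ComNzRing_hasMulInverse.Build {malg R[{cmonom I}]}
    (@cmulVr _) (@cunitP _) (@cinv_out _).
HB.instance Definition _ (R : idomainType) (I : choiceType) :=
  GRing.ComUnitRing_isIntegral.Build {malg R[{cmonom I}]}
    (@malg_mulf_eq0 R I).

(* The field of fractions of R[x_i (i : I)]. *)
Definition polyFrac (R : idomainType) (I : choiceType) : Type :=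
  {fraction {malg R[{cmonom I}]}}.
HB.instance Definition _ (R : idomainType) (I : choiceType) :=
  GRing.Field.on (polyFrac R I).

(* The embeddings are locked to keep unification from unfolding [malg]. *)
HB.lock Definition polyFracP (R : idomainType) (I : choiceType) :
  {malg R[{cmonom I}]} -> polyFrac R I := @FracField.tofrac _.

HB.lock Definition polyFracC (R : idomainType) (I : choiceType) (c : R) :
  polyFrac R I := polyFracP c%:MP.

HB.lock Definition polyFracX (R : idomainType) (I : choiceType) (i : I) :
  polyFrac R I := polyFracP << ucm i >>.

Section PolyFracTheory.
Variables (R : idomainType) (I : choiceType).

Lemma polyFracP_is_zmod_morphism : zmod_morphism (@polyFracP R I).
Proof. by rewrite polyFracP.unlock; exact: tofrac_is_zmod_morphism. Qed.

Lemma polyFracP_is_monoid_morphism : monoid_morphism (@polyFracP R I).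
Proof. by rewrite polyFracP.unlock; exact: tofrac_is_monoid_morphism. Qed.

HB.instance Definition _ := GRing.isZmodMorphism.Build
  {malg R[{cmonom I}]} (polyFrac R I) (@polyFracP R I)
  polyFracP_is_zmod_morphism.
HB.instance Definition _ := GRing.isMonoidMorphism.Build
  {malg R[{cmonom I}]} (polyFrac R I) (@polyFracP R I)
  polyFracP_is_monoid_morphism.

Lemma polyFracC_is_zmod_morphism : zmod_morphism (@polyFracC R I).
Proof. by move=> c d; rewrite polyFracC.unlock !raddfB. Qed.

Lemma polyFracC_is_monoid_morphism : monoid_morphism (@polyFracC R I).
Proof.
split=> [|c d]; rewrite polyFracC.unlock; first by rewrite mpolyC1E rmorph1.
by rewrite mpolyCM rmorphM.
Qed.

HB.instance Definition _ := GRing.isZmodMorphism.Build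
  R (polyFrac R I) (@polyFracC R I) polyFracC_is_zmod_morphism.
HB.instance Definition _ := GRing.isMonoidMorphism.Build
  R (polyFrac R I) (@polyFracC R I) polyFracC_is_monoid_morphism.

Lemma polyFracP_eq0 (p : {malg R[{cmonom I}]}) : (polyFracP p == 0) = (p == 0).
Proof. by rewrite polyFracP.unlock; exact: tofrac_eq0. Qed.

Lemma polyFracX_neq0 (i : I) : polyFracX R i != 0.
Proof.
rewrite polyFracX.unlock polyFracP_eq0; apply/eqP => /malgP /(_ (ucm i)) /eqP.
by rewrite mcoeffUU mcoeff0 oner_eq0.
Qed.
End PolyFracTheory.

(* Fractions iota p / iota (u m), with u multiplicative. *)
Section Fractions.
Variables (P K : comNzRingType) (iota : {rmorphism P -> K}).
Variables (M : conomType) (u : M -> P).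
Hypotheses (u1 : u mone = 1).
Hypotheses (uM : forall m n, u (mmul m n) = u m * u n).

Definition fractions : {pred K} := fun x =>
  `[< exists p m, x * iota (u m) = iota p >].

Lemma fractions_subring : GRing.subring_closed fractions.
Proof.
split=> [|x y /asboolP[p [m xm]] /asboolP[q [n yn]]|
          x y /asboolP[p [m xm]] /asboolP[q [n yn]]]; apply/asboolP.
- by exists 1, mone; rewrite mul1r u1.
- exists (p * u n - q * u m), (mmul m n).
  rewrite uM rmorphB !rmorphM -xm -yn mulrBl mulrA.
  by congr (_ - _); rewrite [RHS]mulrAC mulrA.
- by exists (p * q), (mmul m n); rewrite uM !rmorphM -xm -yn mulrACA.
Qed.
End Fractions.

(* The ring F[t_i^{+-1} (i : I)] of Laurent polynomials, as the subring of
   F(t_i (i : I)) formed by the fractions whose denominator is a monomial. *)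
Section Laurent.
Variables (F : idomainType) (I : choiceType).

Definition laurent_pred : {pred polyFrac F I} := fun x =>
  `[< exists (p : {malg F[{cmonom I}]}) (m : {cmonom I}),
        x * polyFracP << m >> = polyFracP p >].

Lemma laurent_subring : GRing.subring_closed laurent_pred.
Proof.
exact: (@fractions_subring _ _ (@polyFracP F I) {cmonom I}
          (fun m => << m >>) erefl (@malgUM F I)).
Qed.

HB.instance Definition _ :=
  GRing.isSubringClosed.Build (polyFrac F I) laurent_pred laurent_subring.

Record laurent := Laurent {
  laurent_val :> polyFrac F I;
  laurentP : laurent_val \in laurent_pred
}.

HB.instance Definition _ := [isSub for laurent_val].
HB.instance Definition _ := [Choice of laurent by <:].
HB.instance Definition _ :=
  [SubChoice_isSubComNzRing of laurent by <:].
HB.instance Definition _ := GRing.ComNzRing_hasMulInverse.Build laurent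
  (@cmulVr _) (@cunitP _) (@cinv_out _).

Lemma laurent_poly (p : {malg F[{cmonom I}]}) : polyFracP p \in laurent_pred.
Proof. by apply/asboolP; exists p, mone; rewrite [X in _ * X]rmorph1 mulr1. Qed.
End Laurent.

HB.lock Definition laurentC (F : idomainType) (I : choiceType) (c : F) :
  laurent F I := Laurent (laurent_poly c%:MP).

HB.lock Definition laurentX (F : idomainType) (I : choiceType) (i : I) :
  laurent F I := Laurent (laurent_poly << ucm i >>).

Section LaurentTheory.
Variables (F : idomainType) (I : choiceType).

Lemma val_laurentC (c : F) : val (laurentC I c) = polyFracC I c.
Proof. by rewrite laurentC.unlock polyFracC.unlock. Qed.

Lemma val_laurentX (i : I) : val (laurentX F i) = polyFracX F i.
Proof. by rewrite laurentX.unlock polyFracX.unlock. Qed.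

Lemma laurentC_is_zmod_morphism : zmod_morphism (@laurentC F I).
Proof.
by move=> x y; apply/val_inj; rewrite raddfB /= !val_laurentC raddfB.
Qed.

Lemma laurentC_is_monoid_morphism : monoid_morphism (@laurentC F I).
Proof.
split=> [|x y]; apply/val_inj.
  by rewrite val_laurentC !rmorph1.
by rewrite rmorphM /= !val_laurentC rmorphM.
Qed.

HB.instance Definition _ := GRing.isZmodMorphism.Build
  F (laurent F I) (@laurentC F I) laurentC_is_zmod_morphism.
HB.instance Definition _ := GRing.isMonoidMorphism.Build
  F (laurent F I) (@laurentC F I) laurentC_is_monoid_morphism.

Lemma laurentX_unit (i : I) : laurentX F i \is a GRing.unit.
Proof.
have ne0 := polyFracX_neq0 F i.
have iP : (polyFracX F i)^-1 \in @laurent_pred F I.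
  apply/asboolP; exists 1, (ucm i).
  apply: (etrans _ (esym (rmorph1 (@polyFracP F I)))).
  have <- : polyFracX F i = polyFracP << ucm i >> by rewrite polyFracX.unlock.
  exact: mulVf.
apply: (@cunitP _ _ (Laurent iP)); apply/val_inj.
by rewrite rmorphM /= val_laurentX mulVf.
Qed.
End LaurentTheory.

(* s_i on K = Q(A0[lambda]): the finite sum exp((lambda_i/phi_i) ad(phi_i))
   on A0, and s_i(lambda_j) = lambda_j - a_ji lambda_i.  [fsbigop] sums over
   the finite support of the summand. *)
Definition is_weyl_on_K (k : comNzRingType) (I : choiceType)
    (a : I -> I -> int) (A0 : poissonDomainType k) (phi : I -> A0)
    (s : I -> {rmorphism polyFrac A0 I -> polyFrac A0 I}) : Prop :=
  forall i,
  [/\ bijective (s i),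
      forall psi : A0,
        s i (polyFracC I psi) =
          \sum_(n \in [set: nat]%classic)
             n`!%:R^-1 * (polyFracX A0 i / polyFracC I (phi i)) ^+ n
               * polyFracC I (iter n (bracket (phi i)) psi)
    & forall j, s i (polyFracX A0 j) =
                polyFracX A0 j - (a j i)%:~R * polyFracX A0 i].

Definition is_tau_extension (k : comNzRingType) (I : choiceType)
    (a : I -> I -> int) (A0 : poissonDomainType k) (phi : I -> A0)
    (s : I -> {rmorphism polyFrac A0 I -> polyFrac A0 I})
    (S : I -> {rmorphism laurent (polyFrac A0 I) I ->
                         laurent (polyFrac A0 I) I}) : Prop :=
  let tau := @laurentX (polyFrac A0 I) I in
  forall i,
  [/\ bijective (S i),
      forall x, S i (laurentC I x) = laurentC I (s i x),
      forall j, i != j -> S i (tau j) = tau j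
    & S i (tau i) = laurentC I (polyFracC I (phi i)) * tau i
        * \big[*%R/1]_(k \in [set: I]%classic) tau k ^ (- a k i)].

(* Main.v *)
Require Import Defs.
From HB Require Import structures.
From mathcomp Require Import all_boot all_order all_algebra finmap.
From mathcomp Require Import boolp classical_sets cardinality fsbigop.
From mathcomp Require Import reals complex generic_quotient monalg ring zify.

(** Write [xi i = lambda i / phi i] and [D i = {phi i, -}], so that on [A0] the
reflection [s i] is the exponential of [xi i * D i].

Existence.  The exponential of a locally nilpotent derivation is a ring
morphism ([exp_actionM]).  With the prescribed values on the [lambda j] it
extends to polynomials, and from there to fractions because it is injective:
the reflection negates [xi i], so that applying it twice gives back the
argument, up to powers of [phi i] ([weyl_clear_denominators]).  The extension
to Laurent polynomials only has to invert monomials ([laurent_extension]).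

Relations.  A relation between [s i] and [s j] lives in a rank two root system
of type A1 x A1, A2, B2 or G2 ([coxeter_exponent_cases]).  In the first case
everything commutes.  In the others, let [w = i1 ... i2m] be the word
[(s_i s_j)^m].  On [A0] it acts as the product of the exponentials of
[t_k * D i_k], where the time [t_k] is [xi i_k] moved by the reflections that
precede it ([word_act_C]).  The same times enter a product [N] of upper
unitriangular matrices: [exp (t_k * E i_k)] for the simple root vectors [E] in
a representation of dimension 3, 4 or 7 of the rank two Lie algebra.  Put the
[lambda]s on the diagonal and the iterated brackets of the [phi]s below it.
This lower triangular matrix [L] satisfies a Lax equation
[L * exp (xi i * E i) = exp (xi i * E i) * s i L], hence [L * N = N * w L]
([lax_word]).  Both [L] and [w L] have the same diagonal, formed by the
distinct weights of the representation, and a unitriangular intertwiner of two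
such matrices is the identity ([unitriangular_intertwiner]).  So [N = 1]
([wordmx_braid]), which is used twice.

- Multiply all times by an indeterminate [q].  The product of the operator
  exponentials then solves a linear differential equation in [q] whose
  coefficients are the coordinates, in the nilpotent Lie algebra, of the
  logarithmic derivative of [N] along the grading.  They vanish since [N = 1],
  so the product is constant, and at [q = 0] it is the identity
  ([word_exp_trivial]).
- The first half of the word and the inverse of the second half have the same
  matrix.  Its top right corner is a monomial in the times, and the [lambda]s
  of the two halves are opposite.  There remains an identity between monomials
  in the moved [phi]s ([path_monomial_braid]), which is exactly what makes the
  word fix the tau-function of the short simple root ([word_act_t1]).  The
  other tau-function occurs with exponent one in the reflection of this one,
  which is fixed as well, so that it is fixed too ([tau_ext_braid]). *)

Set Implicit Arguments.
Unset Strict Implicit.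
Unset Printing Implicit Defensive.

Import Order.TTheory GRing.Theory Num.Theory.
Local Open Scope ring_scope.

(** * Matrices given by their rows *)

Section RowLists.
Variable K : comNzRingType.
Implicit Types r s : seq (seq K).

Definition lmx m n s : 'M[K]_(m, n) := \matrix_(i, j) (nth [::] s i)`_j.

(** Products and sums of such matrices are again computed on the rows, so that
    identities between explicit matrices reduce to ring identities. *)
Definition ldot (x : seq K) s (j : nat) : K :=
  foldr (fun p a => p.1 * p.2`_j + a) 0 (zip x s).

Definition lmul n r s : seq (seq K) :=
  [seq [seq ldot x s j | j <- iota 0 n] | x <- r].

Definition ladd r s : seq (seq K) :=
  [seq [seq p.1 + p.2 | p <- zip x.1 x.2] | x <- zip r s].

Definition lshape m n s := (size s == m) && all (fun x => size x == n) s.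

Lemma lshape_nth m n s i :
  lshape m n s -> (i < m)%N -> size (nth [::] s i) = n.
Proof.
by case/andP=> /eqP <- /(all_nthP [::]) h im; apply/eqP/h.
Qed.

Lemma mulmx_lmx m n p r s :
  lshape m n r -> lshape n p s -> lmx m n r *m lmx n p s = lmx m p (lmul p r s).
Proof.
move=> rP sP; apply/matrixP => i j; have si := lshape_nth rP (ltn_ord i).
rewrite !mxE /lmul (nth_map [::]); last by case/andP: rP => /eqP ->.
rewrite (nth_map 0%N) ?size_iota // nth_iota // add0n.
have ss : size s = n by case/andP: sP => /eqP.
under eq_bigr do rewrite !mxE.
move: (nth [::] r i) (nat_of_ord j) si => x k sx.
rewrite -(big_mkord xpredT (fun l => x`_l * (nth [::] s l)`_k)) /ldot.
move: (esym ss) (esym sx) => {rP sP ss sx}.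
elim: n x s => [|n IHn] [|x0 x] [|s0 s] //=; first by rewrite big_geq.
by move=> [ss'] [sx']; rewrite big_nat_recl // -IHn.
Qed.

Lemma addmx_lmx m n r s :
  lshape m n r -> lshape m n s -> lmx m n r + lmx m n s = lmx m n (ladd r s).
Proof.
move=> rP sP; apply/matrixP=> i j.
have [rs ss] : size r = m /\ size s = m.
  by case/andP: rP => /eqP; case/andP: sP => /eqP.
have ri := lshape_nth rP (ltn_ord i); have si := lshape_nth sP (ltn_ord i).
rewrite !mxE /ladd (nth_map ([::], [::])) ?size_zip ?rs ?ss ?minnn //.
rewrite nth_zip ?rs ?ss //= (nth_map (0, 0)) ?size_zip ?ri ?si ?minnn //.
by rewrite nth_zip ?ri ?si.
Qed.

Lemma map_lmx (f : {rmorphism K -> K}) m n s :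
  map_mx f (lmx m n s) = lmx m n [seq [seq f x | x <- y] | y <- s].
Proof.
apply/matrixP=> i j; rewrite !mxE.
have [lt_i|ge_i] := ltnP i (size s); last first.
  by rewrite !(nth_default [::]) ?size_map // !nth_nil rmorph0.
rewrite (nth_map [::]) //; have [lt_j|ge_j] := ltnP j (size (nth [::] s i)).
  by rewrite (nth_map 0).
by rewrite !(nth_default 0) ?size_map // rmorph0.
Qed.

Lemma lmx_zero m n : lmx m n (nseq m (nseq n 0)) = 0.
Proof.
by apply/matrixP=> i j; rewrite !mxE !nth_nseq ltn_ord nth_nseq if_same.
Qed.

End RowLists.

Ltac lmx_ring :=
  rewrite /= ?mulmx_lmx ?addmx_lmx //; congr (lmx _ _ _);
  rewrite /lmul /ladd /ldot /=; repeat congr (_ :: _); try ring.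

(** * Unitriangular intertwiners *)

Section Intertwiner.
Variables (K : fieldType) (n : nat).
Implicit Types b M : 'M[K]_n.

Definition unitriangular M :=
  (forall i, M i i = 1) /\ (forall i j : 'I_n, (j < i)%N -> M i j = 0).

Lemma unitriangular1 : unitriangular 1%:M.
Proof.
split=> [i|i j ji]; rewrite mxE ?eqxx //.
by case: eqP => // ij; rewrite ij ltnn in ji.
Qed.

Lemma unitriangularM M N :
  unitriangular M -> unitriangular N -> unitriangular (M *m N).
Proof.
move=> [M1 M0] [N1 N0]; split=> [i|i j ji]; rewrite mxE.
  rewrite (bigD1 i) //= M1 N1 mulr1 big1 ?addr0 // => k ki.
  have [lt_ki|lt_ik|/val_inj e] := ltngtP k i; first by rewrite M0 ?mul0r.
    by rewrite N0 ?mulr0.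
  by rewrite e eqxx in ki.
rewrite big1 // => k _; have [ki|ik] := ltnP k i; first by rewrite M0 ?mul0r.
by rewrite N0 ?mulr0 // (leq_trans ji).
Qed.

Lemma unitriangular_lmx (s : seq (seq K)) :
    all (fun i => all (fun j =>
      if (j < i)%N then (nth [::] s i)`_j == 0
      else (j != i) || ((nth [::] s i)`_j == 1)) (iota 0 n)) (iota 0 n) ->
  unitriangular (lmx n n s).
Proof.
move=> /allP h; split=> [i|i j ji]; rewrite mxE.
  have /h/allP/(_ (val i)) : val i \in iota 0 n by rewrite mem_iota ltn_ord.
  by rewrite mem_iota ltn_ord ltnn eqxx => /(_ isT)/eqP.
have /h/allP/(_ (val j)) : val i \in iota 0 n by rewrite mem_iota ltn_ord.
by rewrite mem_iota ltn_ord ji => /(_ isT)/eqP.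
Qed.

(** Up to entries of [M] further from the diagonal, the entry [(i, j)] of the
    intertwining relation reads [b i i * M i j = M i j * b' j j]. *)
Lemma unitriangular_intertwiner b b' M :
    unitriangular M ->
    (forall i j : 'I_n, (i < j)%N -> b i j = 0) ->
    (forall i j : 'I_n, (i < j)%N -> b' i j = 0) ->
    (forall i, b' i i = b i i) -> injective (fun i => b i i) ->
  b *m M = M *m b' -> M = 1%:M.
Proof.
move=> [M1 M0] bT b'T bb b_inj bM.
suff M_eq0 g (i j : 'I_n) : (i < j)%N -> (n - (j - i) <= g)%N -> M i j = 0.
  apply/matrixP=> i j; rewrite mxE.
  have [ij|ji|/val_inj->] := ltngtP i j; last by rewrite eqxx M1.
    rewrite (M_eq0 n) ?leq_subr //.
    by case: eqP => // e; rewrite e ltnn in ij.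
  by rewrite M0 //; case: eqP => // e; rewrite e ltnn in ji.
(* Downward induction on the distance to the diagonal. *)
elim: g i j => [|g IHg] i j ij.
  by rewrite leqn0 subn_eq0 leqNgt (leq_ltn_trans (leq_subr _ _)).
move=> gij; have := congr1 (fun A : 'M_n => A i j) bM; rewrite !mxE.
rewrite (bigD1 i) //= big1 => [|k ki]; last first.
  have [ik|ik|/val_inj e] := ltngtP i k; first by rewrite bT ?mul0r.
    by rewrite (IHg k j) ?mulr0 //; have := ltn_ord j; lia.
  by rewrite e eqxx in ki.
rewrite (bigD1 j) //= big1 => [|k kj]; last first.
  have [jk|jk|/val_inj e] := ltngtP k j; first by rewrite b'T ?mulr0.
    by rewrite (IHg i k) ?mul0r //; have := ltn_ord k; lia.
  by rewrite e eqxx in kj.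
rewrite !addr0 bb mulrC => /eqP; rewrite -subr_eq0 -mulrBr mulf_eq0 subr_eq0.
by case/orP=> [/eqP//|/eqP/b_inj e]; rewrite e ltnn in ij.
Qed.

End Intertwiner.

(** * Zipped lists *)

Section Zip.
Variables S T : Type.
Implicit Types (s : seq S) (t : seq T).

Lemma take_zip n s t : take n (zip s t) = zip (take n s) (take n t).
Proof. by elim: n s t => [|n IHn] [|x s] [|y t] //=; rewrite IHn. Qed.

Lemma drop_zip n s t : drop n (zip s t) = zip (drop n s) (drop n t).
Proof.
by elim: n s t => [|n IHn] [|x s] [|y t] //=; case: (drop _ _).
Qed.

Lemma zip_mapr U (f : T -> U) s t :
  zip s [seq f y | y <- t] = [seq (q.1, f q.2) | q <- zip s t].
Proof. by elim: s t => [|x s IHs] [|y t] //=; rewrite IHs. Qed.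

End Zip.

(** * Words of twisted automorphisms *)

Fixpoint word_act (R : nzRingType) (s : bool -> {rmorphism R -> R})
    (w : seq bool) : {rmorphism R -> R} :=
  if w is i :: w' then (s i \o word_act s w')%FUN : {rmorphism R -> R}
  else idfun.

Section Twist.
Variables (K : fieldType) (s : bool -> {rmorphism K -> K}).
Implicit Types (w : seq bool) (x : bool -> K).

Fixpoint twist x w : seq K :=
  if w is i :: w' then x i :: [seq s i y | y <- twist x w'] else [::].

Lemma size_twist x w : size (twist x w) = size w.
Proof. by elim: w => //= i w IHw; rewrite size_map IHw. Qed.

(** The times at which the exponentials of a composition of reflections are
    taken: moving a reflection past a letter changes the time of that letter. *)
Definition times x w : seq (bool * K) := zip w (twist x w).

Lemma times_cons x i w :
  times x (i :: w) = (i, x i) :: [seq (p.1, s i p.2) | p <- times x w].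
Proof.
by rewrite /times /= zip_mapr.
Qed.

Lemma eq_twist x y : x =1 y -> twist x =1 twist y.
Proof. by move=> xy; elim=> //= i w ->; rewrite xy. Qed.

Lemma twistM x y w :
  twist (fun i => x i * y i) w =
  [seq q.1 * q.2 | q <- zip (twist x w) (twist y w)].
Proof.
elim: w => //= i w ->; congr (_ :: _).
by elim: (twist x w) (twist y w) => [|u us IHu] [|v vs] //=; rewrite rmorphM IHu.
Qed.

Lemma twist_neq0 x w : (forall i, x i != 0) -> 0 \notin twist x w.
Proof.
move=> x0; elim: w => //= i w IHw; rewrite inE negb_or eq_sym x0.
apply: contra IHw => /mapP[y yw /esym/eqP].
by rewrite fmorph_eq0 => /eqP <-.
Qed.

End Twist.

(** * The rank two root systems *)

(** The simple root [false] is short and the root [true] is long: the Cartan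
    entries of the pair are [- depth] in row [false] and [-1] in row [true].
    The order of the product of the two reflections is [braid], and [dim] is
    the dimension of a representation with distinct weights. *)
Inductive rank2 := A2 | B2 | G2.

Definition depth ty : nat := match ty with A2 => 1 | B2 => 2 | G2 => 3 end.
Definition braid ty : nat := match ty with A2 => 3 | B2 => 4 | G2 => 6 end.
Definition dim ty : nat := match ty with A2 => 3 | B2 => 4 | G2 => 7 end.

Definition alternating m : seq bool := flatten (nseq m [:: false; true]).

(** The pair [(m, n)] of integers stands for the linear form
    [m * lambda false + n * lambda true]. *)
Definition simple_form (i : bool) : int * int := if i then (0, 1) else (1, 0).

Definition reflect_form ty (i : bool) (v : int * int) : int * int :=
  if i then (v.1, (depth ty)%:Z * v.1 - v.2) else (v.2 - v.1, v.2).

Fixpoint twist_form ty (w : seq bool) : seq (int * int) :=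
  if w is i :: w' then
    simple_form i :: [seq reflect_form ty i v | v <- twist_form ty w']
  else [::].

Lemma reflect_form_alternating ty i :
  foldr (reflect_form ty) (simple_form i) (alternating (braid ty)) =
  simple_form i.
Proof. by case: ty i => [] []; vm_compute. Qed.

(** The longest element of the Weyl group acts as [-1] up to the diagram
    automorphism, hence the two halves of the word visit opposite roots. *)
Lemma twist_form_opp ty (t := twist_form ty (alternating (braid ty))) :
  drop (braid ty) t = [seq (- v.1, - v.2) | v <- take (braid ty) t].
Proof. by rewrite {}/t; case: ty; vm_compute. Qed.

Section LinearForms.
Variables (ty : rank2) (K : fieldType) (s : bool -> {rmorphism K -> K}).
Variable lam : bool -> K.
Hypotheses (s00 : s false (lam false) = - lam false)
  (s01 : s false (lam true) = lam true + lam false)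
  (s10 : s true (lam false) = lam false + (depth ty)%:R * lam true)
  (s11 : s true (lam true) = - lam true).

Definition linear_form (v : int * int) : K :=
  v.1%:~R * lam false + v.2%:~R * lam true.

Lemma simple_formE i : linear_form (simple_form i) = lam i.
Proof. by case: i; rewrite /linear_form /= mul0r mul1r ?add0r ?addr0. Qed.

Lemma reflect_formE i v :
  s i (linear_form v) = linear_form (reflect_form ty i v).
Proof.
rewrite /linear_form rmorphD !rmorphM !rmorph_int.
by case: i => /=; rewrite ?s00 ?s01 ?s10 ?s11 ?rmorphB ?rmorphM /=; ring.
Qed.

Lemma word_act_form w v :
  word_act s w (linear_form v) = linear_form (foldr (reflect_form ty) v w).
Proof. by elim: w => //= i w ->; rewrite reflect_formE. Qed.

Lemma twist_lam w : twist s lam w = [seq linear_form v | v <- twist_form ty w].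
Proof.
elim: w => //= i w ->; rewrite simple_formE -!map_comp; congr (_ :: _).
by apply: eq_map => v /=; rewrite reflect_formE.
Qed.

Lemma word_act_alternating v :
  word_act s (alternating (braid ty)) (linear_form v) = linear_form v.
Proof.
have fixed u : word_act s (alternating (braid ty)) (lam u) = lam u.
  by rewrite -simple_formE word_act_form reflect_form_alternating.
by rewrite /linear_form rmorphD !rmorphM !rmorph_int !fixed.
Qed.

Lemma twist_lam_opp (t := twist s lam (alternating (braid ty))) :
  drop (braid ty) t = [seq - y | y <- take (braid ty) t].
Proof.
rewrite /t twist_lam -map_drop -map_take twist_form_opp -!map_comp.
by apply: eq_map => v; rewrite /linear_form /= !rmorphN /=; ring.
Qed.

End LinearForms.

(** * The fundamental representations *)

(** Coordinates along the positive roots of G2, of which A2 and B2 keep three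
    and four: [cp] belongs to the short simple root [alpha], the [c_h] with
    [h <= 3] to the string [beta + h * alpha] through the long simple root, and
    [c5] to [2 * beta + 3 * alpha].  The same record carries both Lie algebra
    elements and the iterated brackets of the two functions [phi]. *)
Record coord (K : Type) :=
  Coord { cp : K; c0 : K; c1 : K; c2 : K; c3 : K; c5 : K }.

Definition coord_map (K L : Type) (f : K -> L) (c : coord K) : coord L :=
  let: Coord p z0 z1 z2 z3 z5 := c in
  Coord (f p) (f z0) (f z1) (f z2) (f z3) (f z5).

Section Representation.
Variables (K : fieldType) (ty : rank2).
Implicit Types (b c : coord K) (t x y : K) (i : bool) (l : seq (bool * K)).

Definition lie_unit i t : coord K :=
  if i then Coord 0 t 0 0 0 0 else Coord t 0 0 0 0 0.

(** How the logarithmic derivative [b] of a group element changes when the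
    element is multiplied on the right by [exp (t E)], for the simple root
    vector [E] of [i]: it is conjugated and [t E] is added to it. *)
Definition lie_step b (q : bool * K) : coord K :=
  let: Coord p z0 z1 z2 z3 z5 := b in let: (i, t) := q in
  if i then Coord p (z0 + t) (z1 + t * p) z2 z3 (z5 - t * z3)
  else Coord (p + t) z0 (z1 - t * z0) (z2 - 2 * t * z1 + t ^+ 2 * z0)
         (z3 - 3 * t * z2 + 3 * t ^+ 2 * z1 - t ^+ 3 * z0) z5.

(** The exponential of [t * {phi i, -}] on the brackets of the two functions
    [phi], in the normalization of [root_coord]. *)
Definition coord_exp i t c : coord K :=
  let: Coord p z0 z1 z2 z3 z5 := c in
  if i then Coord (p - t * z1) z0 z1 z2 (z3 + t * z5) z5
  else Coord p (z0 + t * z1 + t ^+ 2 * z2 + t ^+ 3 * z3)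
         (z1 + 2 * t * z2 + 3 * t ^+ 2 * z3) (z2 + 3 * t * z3) z3 z5.

(** The roots of G2 that are missing in A2 and in B2. *)
Definition truncated c : Prop :=
  match ty with
  | A2 => [/\ c2 c = 0, c3 c = 0 & c5 c = 0]
  | B2 => c3 c = 0 /\ c5 c = 0
  | G2 => True
  end.

(** The exponentials of the simple root vectors, in the representations of
    dimension 3, 4 and 7. *)
Definition expmx i t : 'M[K]_(dim ty) := lmx (dim ty) (dim ty)
  match ty, i with
  | A2, false => [:: [:: 1; t; 0]; [:: 0; 1; 0]; [:: 0; 0; 1]]
  | A2, true => [:: [:: 1; 0; 0]; [:: 0; 1; t]; [:: 0; 0; 1]]
  | B2, false => [:: [:: 1; t; 0; 0]; [:: 0; 1; 0; 0];
                     [:: 0; 0; 1; t]; [:: 0; 0; 0; 1]]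
  | B2, true => [:: [:: 1; 0; 0; 0]; [:: 0; 1; t; 0];
                    [:: 0; 0; 1; 0]; [:: 0; 0; 0; 1]]
  | G2, false =>
      [:: [:: 1; t; 0; 0; 0; 0; 0]; [:: 0; 1; 0; 0; 0; 0; 0];
          [:: 0; 0; 1; 2 * t; t ^+ 2; 0; 0]; [:: 0; 0; 0; 1; t; 0; 0];
          [:: 0; 0; 0; 0; 1; 0; 0]; [:: 0; 0; 0; 0; 0; 1; t];
          [:: 0; 0; 0; 0; 0; 0; 1]]
  | G2, true =>
      [:: [:: 1; 0; 0; 0; 0; 0; 0]; [:: 0; 1; t; 0; 0; 0; 0];
          [:: 0; 0; 1; 0; 0; 0; 0]; [:: 0; 0; 0; 1; 0; 0; 0];
          [:: 0; 0; 0; 0; 1; t; 0]; [:: 0; 0; 0; 0; 0; 1; 0];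
          [:: 0; 0; 0; 0; 0; 0; 1]]
  end.

Definition liemx b : 'M[K]_(dim ty) :=
  let: Coord p z0 z1 z2 z3 z5 := b in lmx (dim ty) (dim ty)
  match ty with
  | A2 => [:: [:: 0; p; z1]; [:: 0; 0; z0]; [:: 0; 0; 0]]
  | B2 => [:: [:: 0; p; z1; - z2]; [:: 0; 0; z0; - z1];
              [:: 0; 0; 0; p]; [:: 0; 0; 0; 0]]
  | G2 => [:: [:: 0; p; z1; - 2 * z2; z3; - z5; 0];
              [:: 0; 0; z0; - 2 * z1; z2; 0; - z5];
              [:: 0; 0; 0; 2 * p; 0; z2; - z3];
              [:: 0; 0; 0; 0; p; z1; - z2];
              [:: 0; 0; 0; 0; 0; z0; - z1];
              [:: 0; 0; 0; 0; 0; 0; p];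
              [:: 0; 0; 0; 0; 0; 0; 0]]
  end.

(** A general element of the opposite Borel subalgebra.  The integers in front
    of the coordinates come from the invariant bilinear form that identifies it
    with the dual of the positive one. *)
Definition laxmx x y c : 'M[K]_(dim ty) :=
  let: Coord p z0 z1 z2 z3 z5 := c in lmx (dim ty) (dim ty)
  match ty with
  | A2 => [:: [:: 2 * x + y; 0; 0]; [:: 3 * p; y - x; 0];
              [:: 3 * z1; 3 * z0; - x - 2 * y]]
  | B2 => [:: [:: x + y; 0; 0; 0]; [:: p; y; 0; 0];
              [:: z1; 2 * z0; - y; 0]; [:: - 2 * z2; - z1; p; - x - y]]
  | G2 => [:: [:: 2 * x + 3 * y; 0; 0; 0; 0; 0; 0];
              [:: p; x + 3 * y; 0; 0; 0; 0; 0];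
              [:: z1; 3 * z0; x; 0; 0; 0; 0];
              [:: - z2; - z1; p; 0; 0; 0; 0];
              [:: 3 * z3; z2; 0; 2 * p; - x; 0; 0];
              [:: - 3 * z5; 0; z2; 2 * z1; 3 * z0; - x - 3 * y; 0];
              [:: 0; - 3 * z5; - 3 * z3; - 2 * z2; - z1; p; - 2 * x - 3 * y]]
  end.

(** The grading operator: its commutator with a root vector multiplies the
    vector by the height of the root, up to sign. *)
Definition heightmx : 'M[K]_(dim ty) := lmx (dim ty) (dim ty)
  match ty with
  | A2 => [:: [:: 0; 0; 0]; [:: 0; 1; 0]; [:: 0; 0; 2]]
  | B2 => [:: [:: 0; 0; 0; 0]; [:: 0; 1; 0; 0];
              [:: 0; 0; 2; 0]; [:: 0; 0; 0; 3]]
  | G2 => [:: [:: 0; 0; 0; 0; 0; 0; 0]; [:: 0; 1; 0; 0; 0; 0; 0];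
              [:: 0; 0; 2; 0; 0; 0; 0]; [:: 0; 0; 0; 3; 0; 0; 0];
              [:: 0; 0; 0; 0; 4; 0; 0]; [:: 0; 0; 0; 0; 0; 5; 0];
              [:: 0; 0; 0; 0; 0; 0; 6]]
  end.

Lemma expmxN i t : expmx i t *m expmx i (- t) = 1%:M.
Proof.
have -> : 1%:M = lmx (dim ty) (dim ty)
   [seq [seq (u == v)%:R : K | v <- iota 0 (dim ty)] | u <- iota 0 (dim ty)].
  apply/matrixP=> j k; rewrite !mxE (nth_map 0%N) ?size_iota //.
  by rewrite (nth_map 0%N) ?size_iota // !nth_iota.
by rewrite /expmx; case: ty i => [] []; lmx_ring.
Qed.

Lemma expmx_unitriangular i t : unitriangular (expmx i t).
Proof.
by apply: unitriangular_lmx; case: ty i => [] [] /=; rewrite !eqxx.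
Qed.

Lemma liemx0 : liemx (Coord 0 0 0 0 0 0) = 0.
Proof.
rewrite -lmx_zero /liemx; case: ty; congr (lmx _ _ _);
by rewrite /= ?mulr0 ?oppr0.
Qed.

Lemma expmx_height i t :
  expmx i t *m heightmx = heightmx *m expmx i t + expmx i t *m liemx (lie_unit i t).
Proof.
by rewrite /expmx /heightmx /liemx /lie_unit; case: ty i => [] []; lmx_ring.
Qed.

Lemma liemx_expmx b i t :
  liemx b *m expmx i t + expmx i t *m liemx (lie_unit i t) =
  expmx i t *m liemx (lie_step b (i, t)).
Proof.
case: b => p z0 z1 z2 z3 z5; rewrite /expmx /liemx /lie_unit /lie_step.
by case: ty i => [] []; lmx_ring.
Qed.

(** The Lax equation for one letter: conjugating the matrix by the exponential
    of a simple root vector keeps it lower triangular when the time is the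
    quotient of the simple form by [phi], and reflects its entries. *)
Lemma laxmx_expmx0 x y c : truncated c -> cp c != 0 ->
  laxmx x y c *m expmx false (x / cp c) =
  expmx false (x / cp c) *m laxmx (- x) (y + x) (coord_exp false (x / cp c) c).
Proof.
case: c => p z0 z1 z2 z3 z5 trc /= p0; set t := x / p.
have -> : x = t * p by rewrite mulfVK.
move: trc; rewrite /truncated /expmx /laxmx /coord_exp; clearbody t.
by case: ty => [[/= e2 e3 e5]|[/= e3 e5]|_]; subst; lmx_ring.
Qed.

Lemma laxmx_expmx1 x y c : truncated c -> c0 c != 0 ->
  laxmx x y c *m expmx true (y / c0 c) =
  expmx true (y / c0 c) *m
    laxmx (x + (depth ty)%:R * y) (- y) (coord_exp true (y / c0 c) c).
Proof.
case: c => p z0 z1 z2 z3 z5 trc /= p0; set t := y / z0.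
have -> : y = t * z0 by rewrite mulfVK.
move: trc; rewrite /truncated /expmx /laxmx /coord_exp; clearbody t.
by case: ty => [[/= e2 e3 e5]|[/= e3 e5]|_]; subst; lmx_ring.
Qed.

Lemma map_expmx (f : {rmorphism K -> K}) i t :
  map_mx f (expmx i t) = expmx i (f t).
Proof.
rewrite /expmx map_lmx; case: ty i => [] []; congr (lmx _ _ _);
by rewrite /= ?(rmorph0, rmorph1, rmorphM, rmorphXn, rmorph_nat).
Qed.

Lemma map_laxmx (f : {rmorphism K -> K}) x y c :
  map_mx f (laxmx x y c) = laxmx (f x) (f y) (coord_map f c).
Proof.
case: c => p z0 z1 z2 z3 z5; rewrite /laxmx map_lmx; case: ty;
congr (lmx _ _ _); rewrite /= ?(rmorph0, rmorphD, rmorphN, rmorphM) /=;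
by rewrite !rmorph1.
Qed.

(** The diagonal of the Lax matrix carries the weights of the representation,
    which have multiplicity one. *)
Definition weights : seq (int * int) :=
  match ty with
  | A2 => [:: (2, 1); (-1, 1); (-1, -2)]
  | B2 => [:: (1, 1); (0, 1); (0, -1); (-1, -1)]
  | G2 => [:: (2, 3); (1, 3); (1, 0); (0, 0); (-1, 0); (-1, -3); (-2, -3)]
  end.

Lemma laxmx_lower x y c (i j : 'I_(dim ty)) :
  (i < j)%N -> laxmx x y c i j = 0.
Proof.
case: c => p z0 z1 z2 z3 z5; rewrite /laxmx mxE.
case: i j => i + [j +] /=; case: ty => /=;
do 7?[case: i => [|i] //]; do 7?[case: j => [|j] //].
Qed.

Lemma laxmx_diag lam c (i : 'I_(dim ty)) :
  laxmx (lam false) (lam true) c i i =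
  linear_form lam (nth (0, 0) weights i).
Proof.
case: c => p z0 z1 z2 z3 z5; rewrite /laxmx mxE /weights /linear_form.
case: i => i +; case: ty => /=; do 7?[case: i => [|i] //] => _ /=; ring.
Qed.

End Representation.

(** * Matrices of words *)

Section WordMatrices.
Variables (K : fieldType) (ty : rank2).
Implicit Types (b c : coord K) (t x y : K) (i : bool) (l : seq (bool * K)).

Definition wordmx l : 'M[K]_(dim ty) :=
  foldr (fun q M => expmx ty q.1 q.2 *m M) 1%:M l.

Lemma wordmx_cat l1 l2 : wordmx (l1 ++ l2) = wordmx l1 *m wordmx l2.
Proof. by elim: l1 => [|q l1 /= ->]; rewrite ?mul1mx ?mulmxA. Qed.

Lemma wordmx_rev l :
  wordmx l *m wordmx (rev [seq (q.1, - q.2) | q <- l]) = 1%:M.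
Proof.
elim: l => [|q l IHl] /=; first by rewrite mulmx1.
rewrite rev_cons -cats1 wordmx_cat /= mulmx1 mulmxA.
by rewrite -[_ *m wordmx l *m _]mulmxA IHl mulmx1 expmxN.
Qed.

Lemma wordmx_unitriangular l : unitriangular (wordmx l).
Proof.
elim: l => [|q l IHl]; first exact: unitriangular1.
exact/unitriangularM/IHl/expmx_unitriangular.
Qed.

Lemma map_wordmx (f : {rmorphism K -> K}) l :
  map_mx f (wordmx l) = wordmx [seq (q.1, f q.2) | q <- l].
Proof. by elim: l => [|q l IHl] /=; rewrite ?map_mx1 // map_mxM map_expmx IHl. Qed.

Definition lie_coord l : coord K := foldl (@lie_step K) (Coord 0 0 0 0 0 0) l.

(** The commutator of a unipotent matrix with the grading operator is its
    logarithmic derivative along the grading, which lies in the nilpotent Lie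
    algebra: only its coordinates there need to be followed along a word. *)
Lemma wordmx_height l :
  wordmx l *m heightmx K ty =
  heightmx K ty *m wordmx l + wordmx l *m liemx ty (lie_coord l).
Proof.
have gen M b :
    M *m heightmx K ty = heightmx K ty *m M + M *m liemx ty b ->
  (M *m wordmx l) *m heightmx K ty = heightmx K ty *m (M *m wordmx l)
    + (M *m wordmx l) *m liemx ty (foldl (@lie_step K) b l).
  elim: l M b => [|q l IHl] M b hM /=; first by rewrite !mulmx1.
  rewrite mulmxA; apply: IHl; case: q => i t /=.
  rewrite -[in LHS]mulmxA expmx_height mulmxDr mulmxA hM mulmxDl -!mulmxA.
  by rewrite -addrA -mulmxDr liemx_expmx.
have := gen 1%:M (Coord 0 0 0 0 0 0); rewrite !mul1mx; apply.
by rewrite mulmx1 liemx0 addr0.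
Qed.

Lemma liemx_inj0 b : liemx ty b = 0 ->
  [/\ cp b = 0, c0 b = 0, c1 b = 0, (1 < depth ty)%N -> c2 b = 0
    & (2 < depth ty)%N -> c3 b = 0 /\ c5 b = 0].
Proof.
case: b => p z0 z1 z2 z3 z5 /matrixP; rewrite /liemx => h.
have {}h (i j : nat) (i_n : (i < dim ty)%N) (j_n : (j < dim ty)%N) :=
  h (Ordinal i_n) (Ordinal j_n).
case: (ty) h => h; split=> //=; try move=> _.
- by have := h 0%N 1%N isT isT; rewrite !mxE /= => ->.
- by have := h 1%N 2%N isT isT; rewrite !mxE /= => ->.
- by have := h 0%N 2%N isT isT; rewrite !mxE /= => ->.
- by have := h 0%N 1%N isT isT; rewrite !mxE /= => ->.
- by have := h 1%N 2%N isT isT; rewrite !mxE /= => ->.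
- by have := h 0%N 2%N isT isT; rewrite !mxE /= => ->.
- by have := h 0%N 3%N isT isT; rewrite !mxE /= => /eqP; rewrite oppr_eq0 => /eqP.
- by have := h 0%N 1%N isT isT; rewrite !mxE /= => ->.
- by have := h 1%N 2%N isT isT; rewrite !mxE /= => ->.
- by have := h 0%N 2%N isT isT; rewrite !mxE /= => ->.
- by have := h 1%N 4%N isT isT; rewrite !mxE /= => ->.
split; first by have := h 0%N 4%N isT isT; rewrite !mxE /= => ->.
by have := h 0%N 5%N isT isT; rewrite !mxE /= => /eqP; rewrite oppr_eq0 => /eqP.
Qed.

Lemma wordmx1_lie_coord l : wordmx l = 1%:M -> liemx ty (lie_coord l) = 0.
Proof.
move=> l1; have := wordmx_height l; rewrite l1 mulmx1 !mul1mx => /esym/eqP.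
by rewrite -[X in _ == X]addr0 (inj_eq (addrI _)) => /eqP.
Qed.

(** The letters of half a braid word lead from the highest to the lowest weight
    along a single path, whence the shape of the top right matrix entry: these
    are the exponents of the successive times in it. *)
Definition path_exponents : seq nat :=
  match ty with
  | A2 => [:: 1; 1; 0]
  | B2 => [:: 1; 1; 1; 0]
  | G2 => [:: 1; 1; 2; 1; 1; 0]
  end%N.

Definition path_monomial (ts : seq K) : K :=
  foldr (fun q a => q.1 ^+ q.2 * a) 1 (zip ts path_exponents).

(** Only the first row of the product is needed, and it can be propagated from
    left to right along the word. *)
Definition row_step (r : seq K) (q : bool * K) : seq K :=
  let: (i, t) := q in
  match ty, i, r with
  | A2, false, [:: x1; x2; x3] => [:: x1; x2 + t * x1; x3]
  | A2, true, [:: x1; x2; x3] => [:: x1; x2; x3 + t * x2]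
  | B2, false, [:: x1; x2; x3; x4] => [:: x1; x2 + t * x1; x3; x4 + t * x3]
  | B2, true, [:: x1; x2; x3; x4] => [:: x1; x2; x3 + t * x2; x4]
  | G2, false, [:: x1; x2; x3; x4; x5; x6; x7] =>
      [:: x1; x2 + t * x1; x3; x4 + 2 * t * x3; x5 + t * x4 + t ^+ 2 * x3; x6;
          x7 + t * x6]
  | G2, true, [:: x1; x2; x3; x4; x5; x6; x7] =>
      [:: x1; x2; x3 + t * x2; x4; x5; x6 + t * x5; x7]
  | _, _, _ => r
  end.

Lemma row_stepE r q : size r = dim ty ->
  lmx 1 (dim ty) [:: r] *m expmx ty q.1 q.2 = lmx 1 (dim ty) [:: row_step r q] /\
  size (row_step r q) = dim ty.
Proof.
case: q => i t /=; rewrite /expmx.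
case: (ty) => /=.
- case: r => [|x1 [|x2 [|x3 [|? ?]]]] // _.
  by split; case: i => //; lmx_ring.
- case: r => [|x1 [|x2 [|x3 [|x4 [|? ?]]]]] // _.
  by split; case: i => //; lmx_ring.
case: r => [|x1 [|x2 [|x3 [|x4 [|x5 [|x6 [|x7 [|? ?]]]]]]]] // _.
by split; case: i => //; lmx_ring.
Qed.

Definition corner l : K :=
  (foldl row_step (1 :: nseq (dim ty).-1 0) l)`_(dim ty).-1.

Lemma wordmx_corner l1 l2 : wordmx l1 = wordmx l2 -> corner l1 = corner l2.
Proof.
have rowE l r : size r = dim ty ->
    lmx 1 (dim ty) [:: r] *m wordmx l = lmx 1 (dim ty) [:: foldl row_step r l].
  elim: l r => [|q l IHl] r sr /=; first by rewrite mulmx1.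
  by have [e s] := row_stepE q sr; rewrite mulmxA e IHl.
move=> e12; have sr : size (1 :: nseq (dim ty).-1 0 : seq K) = dim ty.
  by case: (ty).
have := rowE l1 _ sr; rewrite e12 (rowE l2 _ sr) => /matrixP e; rewrite /corner.
have lt_d : ((dim ty).-1 < dim ty)%N by case: (ty).
by have := e ord0 (Ordinal lt_d); rewrite !mxE.
Qed.

Lemma corner_half (ts : seq K) (l := zip (alternating (braid ty)) ts) :
  size ts = (braid ty).*2 ->
  corner (take (braid ty) l) = path_monomial (take (braid ty) ts) /\
  corner (rev (drop (braid ty) l)) = path_monomial (drop (braid ty) ts).
Proof.
rewrite {}/l /corner /path_monomial /path_exponents /row_step /rev.
case: (ty).
- case: ts => [|t1 [|t2 [|t3 [|t4 [|t5 [|t6 [|? ?]]]]]]] // _.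
  by split; cbn -[GRing.add GRing.mul GRing.exp GRing.one Algebra.add Algebra.zero];
  rewrite ?(mulr0, add0r, addr0); ring.
- case: ts => [|t1 [|t2 [|t3 [|t4 [|t5 [|t6 [|t7 [|t8 [|? ?]]]]]]]]] // _.
  by split; cbn -[GRing.add GRing.mul GRing.exp GRing.one Algebra.add Algebra.zero];
  rewrite ?(mulr0, add0r, addr0); ring.
case: ts => [|t1 [|t2 [|t3 [|t4 [|t5 [|t6 [|t7 [|t8 [|t9 [|t10 [|t11
  [|t12 [|? ?]]]]]]]]]]]]] // _.
by split; cbn -[GRing.add GRing.mul GRing.exp GRing.one Algebra.add Algebra.zero];
  rewrite ?(mulr0, add0r, addr0); ring.
Qed.

Lemma path_monomialM ts us : size ts = size us ->
  path_monomial [seq q.1 * q.2 | q <- zip ts us] =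
  path_monomial ts * path_monomial us.
Proof.
rewrite /path_monomial.
elim: path_exponents ts us => [|e es IHes] [|t ts] [|u us] //=;
  rewrite ?mulr1 // => -[/IHes ->].
by rewrite exprMn; ring.
Qed.

Lemma path_monomialN ts : size ts = braid ty ->
  path_monomial [seq - t | t <- ts] =
  path_monomial (nseq (braid ty) (-1)) * path_monomial ts.
Proof.
move=> sz; rewrite -path_monomialM ?size_nseq // -sz; congr path_monomial.
by elim: ts {sz} => //= t ts <-; rewrite mulN1r.
Qed.

Lemma path_monomial_sign2 : path_monomial (nseq (braid ty) (-1)) ^+ 2 = 1.
Proof. by rewrite /path_monomial /path_exponents; case: (ty) => /=; ring. Qed.

Lemma path_monomial_eq0 ts :
  (path_monomial ts == 0) ==> (0 \in ts).
Proof.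
rewrite /path_monomial.
elim: path_exponents ts => [|e es IHes] [|t ts] //=; rewrite ?oner_eq0 //.
rewrite mulf_eq0 expf_eq0 inE eq_sym; apply/implyP.
by case/orP=> [/andP[_ ->//]|/(implyP (IHes _)) ->]; rewrite ?orbT.
Qed.

End WordMatrices.

(** * The Lax equation *)

Section RankTwo.
Variables (K : fieldType) (ty : rank2) (s : bool -> {rmorphism K -> K}).
Variables (lam : bool -> K) (c : coord K).
Hypotheses (s00 : s false (lam false) = - lam false)
  (s01 : s false (lam true) = lam true + lam false)
  (s10 : s true (lam false) = lam false + (depth ty)%:R * lam true)
  (s11 : s true (lam true) = - lam true).
Hypothesis lam_free : forall v, linear_form lam v = 0 -> v = (0, 0).

Let phi (i : bool) := if i then c0 c else cp c.
Let xi i := lam i / phi i.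

Hypothesis phi_neq0 : forall i, phi i != 0.
Hypothesis c_trunc : truncated ty c.
Hypothesis sc : forall i, coord_map (s i) c = coord_exp i (xi i) c.

Let L := laxmx ty (lam false) (lam true) c.
Let w := alternating (braid ty).

(** The Lax equations of the letters compose: each letter transforms the times
    of the letters on its right in the way prescribed by [times]. *)
Lemma lax_word u :
  L *m wordmx ty (times s xi u) =
  wordmx ty (times s xi u) *m map_mx (word_act s u) L.
Proof.
have step i : L *m expmx ty i (xi i) = expmx ty i (xi i) *m map_mx (s i) L.
  rewrite /L map_laxmx sc; case: i.
    by rewrite s10 s11 -laxmx_expmx1 // (phi_neq0 true).
  by rewrite s00 s01 -laxmx_expmx0 // (phi_neq0 false).
elim: u => [|i u IHu]; first by rewrite /times /= mulmx1 mul1mx map_mx_id.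
rewrite times_cons /= -map_wordmx mulmxA step -mulmxA -map_mxM IHu.
by rewrite map_mxM mulmxA -map_mx_comp.
Qed.

(** Both sides of the Lax equation for the full word are lower triangular with
    the weights, which are pairwise distinct, on the diagonal. *)
Lemma wordmx_braid : wordmx ty (times s xi w) = 1%:M.
Proof.
apply: (unitriangular_intertwiner _ _ _ _ _ (lax_word w)).
- exact: wordmx_unitriangular.
- exact: laxmx_lower.
- by move=> i j ij; rewrite mxE laxmx_lower // rmorph0.
- by move=> i; rewrite mxE laxmx_diag word_act_alternating.
move=> i j /eqP; rewrite !laxmx_diag -subr_eq0 => /eqP.
move=> uv; apply/val_inj/eqP.
have sz : size (weights ty) = dim ty by case: (ty).
rewrite -(@nth_uniq _ (0, 0) (weights ty)) ?sz ?ltn_ord //; last by case: (ty).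
move: (nth _ _ i) (nth _ _ j) uv => [u1 u2] [v1 v2] uv.
have /lam_free[] : linear_form lam (u1 - v1, u2 - v2) = 0.
  by rewrite -uv /linear_form !rmorphB /=; ring.
by move=> /eqP + /eqP; rewrite !subr_eq0 => /eqP -> /eqP ->.
Qed.

Lemma lie_coord_braid : liemx ty (lie_coord (times s xi w)) = 0.
Proof. exact/wordmx1_lie_coord/wordmx_braid. Qed.

(** Since the whole word has matrix 1, its first half and the inverse of its
    second half have the same corner entry.  These entries are monomials in
    the times, that is, in quotients of moved [lambda]s by moved [phi]s, and the
    [lambda]s of the two halves agree up to sign. *)
Lemma path_monomial_braid :
  path_monomial ty (take (braid ty) (twist s phi w)) =
  path_monomial ty (drop (braid ty) (twist s phi w)).
Proof.
pose ts := twist s xi w; pose P := path_monomial (K := K) ty.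
have size_tw x : size (twist s x w) = (braid ty).*2.
  by rewrite size_twist /w; case: (ty).
have size_take x : size (take (braid ty) (twist s x w)) = braid ty.
  by rewrite size_takel // size_tw -addnn leq_addr.
have size_drop x : size (drop (braid ty) (twist s x w)) = braid ty.
  by rewrite size_drop size_tw -addnn addnK.
have tsE : P (take (braid ty) ts) = P [seq - t | t <- drop (braid ty) ts].
  rewrite /P map_drop.
  have [<- _] := corner_half (size_tw xi); set us := [seq - t | t <- ts].
  have size_us : size us = (braid ty).*2 by rewrite size_map size_tw.
  have [_ <-] := corner_half size_us.
  rewrite /us zip_mapr -map_drop -/(times s xi w); apply: wordmx_corner.
  rewrite -[LHS]mulmx1 -(wordmx_rev ty (drop (braid ty) (times s xi w))).
  by rewrite mulmxA -wordmx_cat cat_take_drop wordmx_braid mul1mx.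
have lamE : twist s lam w = [seq q.1 * q.2 | q <- zip ts (twist s phi w)].
  by rewrite -twistM; apply: eq_twist => i; rewrite /xi mulfVK.
have := twist_lam_opp s00 s01 s10 s11 => /(congr1 P).
rewrite /P path_monomialN ?size_take // -/w lamE -map_drop -map_take.
rewrite drop_zip take_zip !path_monomialM ?size_take ?size_drop // -!/(P _).
rewrite tsE /P path_monomialN ?size_drop // !mulrA -expr2 path_monomial_sign2.
rewrite mul1r => /esym; apply: mulfI; apply/negP.
move/(implyP (path_monomial_eq0 _ _))/mem_drop; apply/negP/twist_neq0 => i.
rewrite mulf_neq0 ?invr_eq0 //; apply/eqP.
rewrite -(simple_formE lam) => /lam_free; by case: i.
Qed.

End RankTwo.

(** * Exponentials of locally nilpotent operators *)

Section Antidiagonal.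
Variable T : nmodType.
Implicit Types F : nat -> nat -> T.

Lemma sum_antidiagonal F N :
  \sum_(n < N) \sum_(k < n.+1) F k (n - k)%N =
  \sum_(k < N) \sum_(l < N - k) F k l.
Proof.
elim: N => [|N IHN]; first by rewrite !big_ord0.
rewrite big_ord_recr IHN /= [in RHS]big_ord_recr subSnn /= big_ord1.
rewrite [X in _ + X]big_ord_recr subnn addrA /=; congr (_ + _).
rewrite -big_split; apply: eq_bigr => k _ /=.
by rewrite subSn ?big_ord_recr // ltnW.
Qed.

Lemma sum_antidiagonal_box F M : (forall k l, (M <= k)%N || (M <= l)%N -> F k l = 0) ->
  \sum_(n < M + M) \sum_(k < n.+1) F k (n - k)%N =
  \sum_(k < M) \sum_(l < M) F k l.
Proof.
move=> F0; rewrite sum_antidiagonal big_split_ord /= [X in _ + X]big1 ?addr0.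
  apply: eq_bigr => k _; rewrite -addnBA ?big_split_ord /=; last exact: ltnW.
  by rewrite [X in _ + X]big1 ?addr0 // => l _; rewrite F0 // leq_addr orbT.
by move=> k _; rewrite big1 // => l _; rewrite F0 // leq_addr.
Qed.

End Antidiagonal.

Section DividedPowers.
Variable T : comUnitRingType.
Hypothesis natT_unit : forall n, n.+1%:R \is a @GRing.unit T.
Implicit Types u v : T.

Definition divpow u n : T := n`!%:R^-1 * u ^+ n.

Lemma divpow0 u : divpow u 0 = 1.
Proof. by rewrite /divpow invr1 mulr1. Qed.

Lemma fact_unit n : n`!%:R \is a @GRing.unit T.
Proof. by case: n`! (fact_gt0 n). Qed.

Lemma divpow_comb u v k n : (k <= n)%N ->
  divpow u k * divpow v (n - k) = n`!%:R^-1 * 'C(n, k)%:R * (u ^+ k * v ^+ (n - k)).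
Proof.
move=> kn; rewrite /divpow mulrACA; congr (_ * _).
apply: (mulrI (fact_unit n)); rewrite [RHS]mulrA divrr ?fact_unit // mul1r.
rewrite -(bin_fact kn) !natrM -mulrA mulrACA !divrr ?fact_unit //.
by rewrite !mulr1.
Qed.

Lemma divpowD u v n :
  divpow (u + v) n = \sum_(k < n.+1) divpow u k * divpow v (n - k).
Proof.
rewrite /divpow addrC exprDn mulr_sumr; apply: eq_bigr => k _.
rewrite divpow_comb; last by rewrite -ltnS.
by rewrite -[RHS]mulrA mulr_natl [v ^+ _ * _]mulrC.
Qed.

Lemma divpowMn u k n : (k <= n)%N ->
  divpow u n * 'C(n, k)%:R = divpow u k * divpow u (n - k).
Proof.
by move=> kn; rewrite divpow_comb // -exprD subnKC // /divpow mulrAC.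
Qed.

Lemma divpowN u n : divpow (- u) n = (-1) ^+ n * divpow u n.
Proof. by rewrite /divpow mulrCA -exprNn. Qed.

Lemma divpow0l n : divpow 0 n = (n == 0%N)%:R.
Proof.
by case: n => [|n]; rewrite /divpow ?expr0 ?expr0n /= ?mulr0 // invr1 mulr1.
Qed.

End DividedPowers.

Record nilop (V : zmodType) := NilOp {
  nilop_fun :> {additive V -> V};
  nilopP : forall x, exists N, iter N nilop_fun x = 0
}.

Section Iterates.
Variable V : zmodType.
Implicit Types (D : {additive V -> V}) (x y : V).

Lemma iter_additive D n : zmod_morphism (iter n D).
Proof. by elim: n => [|n IHn] x y //; rewrite !iterS IHn raddfB. Qed.

Lemma iter0l D n : iter n D 0 = 0.
Proof. by elim: n => //= n ->; rewrite raddf0. Qed.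

Lemma iter_nil D n m x : (n <= m)%N -> iter n D x = 0 -> iter m D x = 0.
Proof. by move=> /subnK <- Dx; rewrite iterD Dx iter0l. Qed.

Lemma nilop_bound (D : nilop V) n (x : nat -> V) :
  exists N, forall k, (k < n)%N -> iter N D (x k) = 0.
Proof.
elim: n => [|n [N xN]]; first by exists 0%N.
have [M xM] := nilopP D (x n); exists (maxn N M) => k.
rewrite ltnS leq_eqVlt => /orP[/eqP->|kn].
  exact: iter_nil (leq_maxr _ _) xM.
exact: iter_nil (leq_maxl _ _) (xN k kn).
Qed.

End Iterates.

(** The exponential of [u D], followed by [f]: the values of [f] may lie in a
    larger ring, to which [u] belongs. *)
Section ExpAction.
Variables (V : zmodType) (T : comUnitRingType).
Hypothesis natT_unit : forall n, n.+1%:R \is a @GRing.unit T.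

Definition exp_action (D : V -> V) (f : V -> T) (u : T) (x : V) : T :=
  \sum_(n \in [set: nat]%classic) n`!%:R^-1 * u ^+ n * f (iter n D x).

Lemma exp_actionE (D : {additive V -> V}) (f : {additive V -> T}) u x N :
  iter N D x = 0 ->
  exp_action D f u x = \sum_(k < N) divpow u k * f (iter k D x).
Proof.
move=> DN; rewrite -(big_mkord xpredT (fun k => divpow u k * f (iter k D x))).
rewrite /exp_action (fsbigE (index_iota 0 N)) ?iota_uniq //.
  by apply: eq_bigl => k; rewrite in_setT.
move=> k _; rewrite mem_index_iota /= -leqNgt => Nk.
by rewrite (iter_nil Nk DN) raddf0 mulr0.
Qed.

Variable D : nilop V.

Lemma exp_action_additive (f : {additive V -> T}) u :
  zmod_morphism (exp_action D f u).
Proof.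
move=> x y; have [N] := nilop_bound D 2 (fun k => if k is 0 then x else y).
move=> DN; have [/= Dx Dy] := (DN 0%N isT, DN 1%N isT).
have Dxy : iter N D (x - y) = 0 by rewrite iter_additive Dx Dy subr0.
rewrite !(exp_actionE _ _ Dx, exp_actionE _ _ Dy, exp_actionE _ _ Dxy).
rewrite -sumrB; apply: eq_bigr => k _.
by rewrite iter_additive raddfB mulrBr.
Qed.

HB.instance Definition _ f u := GRing.isZmodMorphism.Build V T
  (exp_action D (Algebra.Additive.sort f) u) (exp_action_additive f u).

Lemma exp_action0 (f : {additive V -> T}) x : exp_action D f 0 x = f x.
Proof.
have [N DN] := nilopP D x; rewrite (exp_actionE _ _ (iter_nil (leqnSn N) DN)).
rewrite big_ord_recl divpow0 mul1r big1 ?addr0 // => k _.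
by rewrite divpow0l mul0r.
Qed.

Lemma exp_actionD (f : {additive V -> T}) u v x :
  exp_action D (exp_action D f u) v x = exp_action D f (u + v) x.
Proof.
have [N DN] := nilopP D x.
pose F k l := divpow v k * divpow u l * f (iter (k + l) D x).
rewrite [LHS](exp_actionE _ _ DN).
rewrite [RHS](exp_actionE _ _ (iter_nil (leq_addr N N) DN)).
transitivity (\sum_(k < N) \sum_(l < N) F k l).
  apply: eq_bigr => k _; rewrite /= (exp_actionE _ _ (N := N)); last first.
    by rewrite -iterD (iter_nil (leq_addr _ _) DN).
  rewrite mulr_sumr; apply: eq_bigr => l _.
  by rewrite -iterD addnC /F mulrA.
rewrite -sum_antidiagonal_box => [|k l kl]; last first.
  rewrite /F (iter_nil _ DN) ?raddf0 ?mulr0 //.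
  by case/orP: kl => ?; [apply: leq_trans (leq_addr _ _)|apply: leq_trans (leq_addl _ _)].
apply: eq_bigr => n _; rewrite addrC divpowD // mulr_suml.
by apply: eq_bigr => k _; rewrite /F subnKC // -ltnS.
Qed.

Lemma exp_actionNK (f : {additive V -> T}) u x :
  exp_action D (exp_action D f u) (- u) x = f x.
Proof. by rewrite exp_actionD subrr exp_action0. Qed.

Lemma exp_action_commute_divpow (f g : {additive V -> T}) (e : nat -> V -> V)
    n u x :
    (forall y, g y = f (e 0%N y)) ->
    (forall j y, D (e j y) = e j (D y) + e j.+1 y) ->
    (forall j y, (n <= j)%N -> e j y = 0) ->
  exp_action D g u x =
  \sum_(j < n) divpow (- u) j * exp_action D f u (e j x).
Proof.
move=> gE eD e0.
pose c k j : int := (-1) ^+ j * 'C(k, j)%:Z.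
have comm k y : e 0%N (iter k D y) =
    \sum_(j < k.+1) iter (k - j) D (e j y) *~ c k j.
  elim: k y => [|k IHk] y; first by rewrite big_ord1 mulr1z.
  rewrite iterSr IHk.
  transitivity (\sum_(j < k.+1) iter (k.+1 - j) D (e j y) *~ c k j
      - \sum_(j < k.+1) iter (k - j) D (e j.+1 y) *~ c k j).
    rewrite -sumrB; apply: eq_bigr => j _; rewrite -mulrzBl; congr (_ *~ _).
    have -> : e j (D y) = D (e j y) - e j.+1 y by rewrite eD addrK.
    by rewrite iter_additive -iterSr subSn // -ltnS.
  transitivity (\sum_(j < k.+2) iter (k.+1 - j) D (e j y) *~ c k j
      - \sum_(j < k.+1) iter (k - j) D (e j.+1 y) *~ c k j).
    by rewrite [in RHS]big_ord_recr /= [c k k.+1]/c bin_small // mulr0 mulr0z addr0.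
  rewrite big_ord_recl [in RHS]big_ord_recl -addrA; congr (_ + _).
    by rewrite /c !bin0.
  rewrite -sumrB; apply: eq_bigr => j _; rewrite /= /bump !add1n subSS -mulrzBr.
  by congr (_ *~ _); rewrite /c binS PoszD exprS; ring.
have [N eN] := nilop_bound D n (e^~ x); have [M xM] := nilopP D x.
pose P := maxn (maxn N M) n.
have NP : (N <= P)%N by rewrite !leq_max leqnn.
have MP : (M <= P)%N by rewrite !leq_max leqnn orbT.
have nP : (n <= P)%N by rewrite leq_max leqnn orbT.
have xP := iter_nil MP xM.
have eP j : iter P D (e j x) = 0.
  have [jn|nj] := ltnP j n; first exact: iter_nil NP (eN j jn).
  by rewrite e0 // iter0l.
pose F j l := divpow (- u) j * (divpow u l * f (iter l D (e j x))).
rewrite (exp_actionE _ _ (iter_nil (leq_addr P P) xP)).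
transitivity (\sum_(j < P) \sum_(l < P) F j l).
  rewrite -sum_antidiagonal_box => [|j l /orP[nj|lP]]; last first.
  - by rewrite /F (iter_nil lP (eP j)) raddf0 !mulr0.
  - by rewrite /F e0 ?(leq_trans nP) // iter0l raddf0 !mulr0.
  apply: eq_bigr => k _; rewrite gE comm raddf_sum mulr_sumr.
  apply: eq_bigr => j _; rewrite raddfMz /F -mulrzl.
  suff key : divpow (- u) j * divpow u (k - j) = divpow u k * (c k j)%:~R.
    by rewrite [RHS]mulrA key -mulrA.
  rewrite divpowN -mulrA -divpowMn // -1?ltnS // /c intrM rmorphXn rmorphN1.
  by rewrite mulrCA.
have PE : P = (n + (P - n))%N by rewrite subnKC.
rewrite PE big_split_ord /= [X in _ + X]big1 ?addr0 => [|j _]; last first.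
  by rewrite big1 // => l _; rewrite /F e0 ?leq_addr // iter0l raddf0 !mulr0.
rewrite -PE; apply: eq_bigr => j _.
by rewrite (exp_actionE _ _ (eP j)) mulr_sumr.
Qed.

(** Moving an operator [e 0] from the left to the right of the exponential
    replaces it by [exp (- u ad D)] applied to it, where [e j] is the [j]-th
    divided power of [ad D] at [e 0]. *)
Lemma exp_action_commute (f g : {additive V -> T}) (e : nat -> V -> V) n u x :
    (forall y, g y = f (e 0%N y)) ->
    (forall j y, D (e j y) = e j (D y) + e j.+1 y *+ j.+1) ->
    (forall j y, (n <= j)%N -> e j y = 0) ->
  exp_action D g u x = \sum_(j < n) (- u) ^+ j * exp_action D f u (e j x).
Proof.
move=> gE eD e0; pose e' j y := e j y *+ j`!.
rewrite (exp_action_commute_divpow (f := f) (e := e') (n := n)); last first.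
- by move=> j y nj; rewrite /e' e0 // mul0rn.
- by move=> j y; rewrite /e' raddfMn eD mulrnDl -mulrnA -factS.
- by move=> y; rewrite gE /e' mulr1n.
apply: eq_bigr => j _; rewrite /e' raddfMn -mulr_natl mulrA; congr (_ * _).
by rewrite /divpow mulrAC mulVr ?mul1r ?fact_unit.
Qed.

Lemma exp_action_ext (f g : V -> T) u x :
  f =1 g -> exp_action D f u x = exp_action D g u x.
Proof. by move=> fg; apply: eq_fsbigr => n _; rewrite fg. Qed.

End ExpAction.

Lemma exp_actionC (V : zmodType) (T : comUnitRingType) (D E : nilop V)
    (f : {additive V -> T}) u v x :
    (forall y, D (E y) = E (D y)) ->
  exp_action E (exp_action D f u) v x = exp_action D (exp_action E f v) u x.
Proof.
move=> DE; have [N DN] := nilopP D x; have [M EM] := nilopP E x.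
have iterC n m y : iter n D (iter m E y) = iter m E (iter n D y).
  have iterC1 z : iter n D (E z) = E (iter n D z).
    by elim: n => //= n ->; rewrite DE.
  by elim: m => //= m <-; rewrite iterC1.
have DNE m : iter N D (iter m E x) = 0 by rewrite iterC DN iter0l.
have EMD n : iter M E (iter n D x) = 0 by rewrite -iterC EM iter0l.
rewrite [LHS](exp_actionE _ _ EM) [RHS](exp_actionE _ _ DN) /=.
under eq_bigr do rewrite (exp_actionE _ _ (DNE _)) mulr_sumr.
under [RHS]eq_bigr do rewrite (exp_actionE _ _ (EMD _)) mulr_sumr.
rewrite exchange_big; apply: eq_bigr => n _; apply: eq_bigr => m _.
by rewrite mulrCA iterC.
Qed.

(** Applying a morphism after an exponential only changes its parameter: hence
    a composition of reflections is a product of exponentials on [A0], taken at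
    moved times. *)
Lemma rmorph_exp_action (V : zmodType) (T T' : comUnitRingType)
    (D : nilop V) (f : {additive V -> T}) (g : {rmorphism T -> T'}) u x :
    (forall n, n.+1%:R \is a @GRing.unit T) ->
  g (exp_action D f u x) = exp_action D (g \o f) (g u) x.
Proof.
move=> T_unit; have [N DN] := nilopP D x.
rewrite (exp_actionE _ _ DN) (exp_actionE (g \o f) _ DN) rmorph_sum.
apply: eq_bigr => k _; rewrite !rmorphM /divpow rmorphXn rmorphV ?fact_unit //.
by rewrite rmorph_nat.
Qed.

(** * Derivations *)

Section Leibniz.
Variables (V : zmodType) (op : V -> V -> V) (D : {additive V -> V}).
Hypotheses (opl : forall y, zmod_morphism (op^~ y))
  (opr : forall x, zmod_morphism (op x))
  (D_op : forall x y, D (op x y) = op (D x) y + op x (D y)).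

Lemma iter_Leibniz n x y :
  iter n D (op x y) =
  \sum_(k < n.+1) op (iter k D x) (iter (n - k) D y) *+ 'C(n, k).
Proof.
elim: n => [|n IHn]; first by rewrite big_ord1.
rewrite iterS IHn raddf_sum.
transitivity (\sum_(k < n.+1) op (iter k.+1 D x) (iter (n - k) D y) *+ 'C(n, k)
  + \sum_(k < n.+1) op (iter k D x) (iter (n.+1 - k) D y) *+ 'C(n, k)).
  rewrite -big_split; apply: eq_bigr => k _ /=.
  by rewrite raddfMn D_op mulrnDl -!iterS subSn // -ltnS.
rewrite [RHS]big_ord_recl [X in _ + X]big_ord_recl /= addrCA; congr (_ + _).
  by rewrite !bin0.
have -> : \sum_(k < n) op (iter (bump 0 k) D x) (iter (n.+1 - bump 0 k) D y)
      *+ 'C(n, bump 0 k) =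
    \sum_(k < n.+1) op (iter k.+1 D x) (iter (n - k) D y) *+ 'C(n, k.+1).
  by rewrite [RHS]big_ord_recr /= bin_small // mulr0n addr0.
rewrite -big_split; apply: eq_bigr => k _ /=.
by rewrite /bump add1n subSS binS mulrnDr addrC.
Qed.

Lemma iter_nil_op n m x y :
  iter n D x = 0 -> iter m D y = 0 -> iter (n + m) D (op x y) = 0.
Proof.
have op0l z : op 0 z = 0 by have := opl z 0 0; rewrite !subrr.
have op0r z : op z 0 = 0 by have := opr z 0 0; rewrite !subrr.
move=> Dx Dy; rewrite iter_Leibniz big1 // => k _.
have [nk|kn] := leqP n k; first by rewrite (iter_nil nk Dx) op0l mul0rn.
by rewrite (iter_nil _ Dy) ?op0r ?mul0rn //; lia.
Qed.

End Leibniz.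

(** By the binomial form of Leibniz' rule, the exponential of a derivation is
    multiplicative. *)
Lemma exp_actionM (A T : comUnitRingType) (D : nilop A) (f : {rmorphism A -> T})
    (u : T) x y :
    (forall n, n.+1%:R \is a @GRing.unit T) ->
    (forall a b, D (a * b) = D a * b + a * D b) ->
  exp_action D f u (x * y) = exp_action D f u x * exp_action D f u y.
Proof.
move=> T_unit DM.
have [N DN] := nilop_bound D 2 (fun k => if k is 0 then x else y).
have [/= Dx Dy] := (DN 0%N isT, DN 1%N isT) => {DN}.
have mull z : zmod_morphism (fun a : A => a * z) by move=> a b; rewrite mulrBl.
have mulr z : zmod_morphism ( *%R z : A -> A) by move=> a b; rewrite mulrBr.
rewrite (exp_actionE _ _ Dx) (exp_actionE _ _ Dy).
rewrite (exp_actionE _ _ (iter_nil_op mull mulr DM Dx Dy)).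
pose F k l := divpow u k * divpow u l * (f (iter k D x) * f (iter l D y)).
transitivity (\sum_(k < N) \sum_(l < N) F k l); last first.
  rewrite mulr_suml; apply: eq_bigr => k _; rewrite mulr_sumr.
  by apply: eq_bigr => l _; rewrite /F mulrACA.
rewrite -sum_antidiagonal_box => [|k l /orP[Nk|Nl]]; last first.
- by rewrite /F (iter_nil Nl Dy) rmorph0 !mulr0.
- by rewrite /F (iter_nil Nk Dx) rmorph0 mul0r mulr0.
apply: eq_bigr => n _; rewrite (iter_Leibniz DM) raddf_sum mulr_sumr.
apply: eq_bigr => k _; rewrite /F -divpowMn // -1?ltnS //.
by rewrite raddfMn /= rmorphM -[RHS]mulrA mulr_natl.
Qed.

(** * A linear differential equation *)

Section Derivative.
Variables (V : zmodType) (K : fieldType).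
Hypothesis K0 : forall n, n.+1%:R != 0 :> K.
Variable D : nilop V.

Lemma natr_unit n : n.+1%:R \is a @GRing.unit K.
Proof. by rewrite unitfE. Qed.

Lemma natX_unit n : n.+1%:R \is a @GRing.unit {poly K}.
Proof. by rewrite -(rmorph_nat (@polyC K)) rmorph_unit ?natr_unit. Qed.

Lemma deriv_divpow (t : K) n :
  (divpow (t%:P * 'X) n.+1)^`() = t%:P * divpow (t%:P * 'X) n.
Proof.
have factV m : m`!%:R^-1 = (m`!%:R^-1)%:P :> {poly K}.
  by rewrite -polyC_natr polyCV.
rewrite /divpow !factV derivM derivC mul0r add0r deriv_exp derivM derivC derivX.
rewrite mul0r add0r mulr1 /= mulrnAr -mulrnAl -polyCMn [LHS]mulrCA.
congr (_ * (_%:P * _)); rewrite factS natrM invfM -[_ *+ n.+1]mulr_natl mulrA.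
by rewrite mulfV ?mul1r.
Qed.

(** Product rule for the derivative along the indeterminate, which occurs both
    in the parameter of the exponential and in the values of [f]. *)
Lemma deriv_exp_action (f : {additive V -> {poly K}}) (t : K) x :
  (exp_action D f (t%:P * 'X) x)^`() =
  t%:P * exp_action D f (t%:P * 'X) (D x)
    + exp_action D (@deriv K \o f) (t%:P * 'X) x.
Proof.
have [N DN] := nilopP D x.
rewrite (exp_actionE _ _ (iter_nil (leqnSn N) DN)).
have DN' : iter N D (D x) = 0 by rewrite -iterSr (iter_nil _ DN).
rewrite (exp_actionE f _ DN') (exp_actionE (@deriv K \o f) _ (iter_nil (leqnSn N) DN)).
rewrite raddf_sum mulr_sumr /=.
under eq_bigr do rewrite derivM; rewrite big_split /=; congr (_ + _).
rewrite big_ord_recl divpow0 derivC mul0r add0r; apply: eq_bigr => k _.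
by rewrite deriv_divpow -mulrA -iterSr.
Qed.

End Derivative.

(** * Words of exponentials *)

Section WordExp.
Variables (V : zmodType) (D : bool -> nilop V).

Definition word_exp (T : comUnitRingType) (f : {additive V -> T})
    (l : seq (bool * T)) : {additive V -> T} :=
  foldl (fun (g : {additive V -> T}) q =>
    (exp_action (D q.1) g q.2 : {additive V -> T})) f l.

Lemma rmorph_word_exp (T T' : comUnitRingType) (g : {rmorphism T -> T'})
    (f : {additive V -> T}) (f' : {additive V -> T'}) l x :
  (forall n, n.+1%:R \is a @GRing.unit T) -> g \o f =1 f' ->
  g (word_exp f l x) = word_exp f' [seq (q.1, g q.2) | q <- l] x.
Proof.
move=> T_unit; elim: l f f' => [|q l IHl] f f' ff' /=; first exact: ff'.
apply: IHl => y /=; rewrite rmorph_exp_action //.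
exact: exp_action_ext.
Qed.

Lemma word_exp0 (T : comUnitRingType) (f : {additive V -> T}) l x :
  (forall q, q \in l -> q.2 = 0) -> word_exp f l x = f x.
Proof.
move=> l0.
suff: forall g : {additive V -> T}, g =1 f -> word_exp g l x = f x by exact.
elim: l l0 => [|q l IHl] l0 g gf /=; first exact: gf.
apply: IHl => [r rl|y /=]; first by rewrite l0 // inE rl orbT.
by rewrite l0 ?inE ?eqxx // exp_action0.
Qed.

End WordExp.

Section RankTwoOperators.
Variables (V : zmodType) (K : fieldType) (D : bool -> nilop V).
Variables e1 e2 e3 e5 : {additive V -> V}.
Hypothesis K0 : forall n, n.+1%:R != 0 :> K.
Hypotheses
  (e01 : forall x, D false (D true x) = D true (D false x) + e1 x)
  (e02 : forall x, D false (e1 x) = e1 (D false x) + e2 x *+ 2)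
  (e03 : forall x, D false (e2 x) = e2 (D false x) + e3 x *+ 3)
  (e04 : forall x, D false (e3 x) = e3 (D false x))
  (e05 : forall x, D false (e5 x) = e5 (D false x))
  (e11 : forall x, D true (e1 x) = e1 (D true x))
  (e12 : forall x, D true (e2 x) = e2 (D true x))
  (e13 : forall x, D true (e3 x) = e3 (D true x) + e5 x)
  (e15 : forall x, D true (e5 x) = e5 (D true x)).

(** The differential equation of a word: the root vector of height [h] comes
    with ['X ^+ h.-1], as it would from the derivative of ['X ^+ h]. *)
Definition ode (b : coord K) (f : V -> {poly K}) : Prop := forall x,
  (f x)^`() = (cp b)%:P * f (D false x) + (c0 b)%:P * f (D true x)
    + (c1 b)%:P * 'X * f (e1 x) + (c2 b)%:P * 'X ^+ 2 * f (e2 x)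
    + (c3 b)%:P * 'X ^+ 3 * f (e3 x) + (c5 b)%:P * 'X ^+ 4 * f (e5 x).

Let exp (i : bool) (t : K) (f : V -> {poly K}) := exp_action (D i) f (t%:P * 'X).

Lemma ode_deriv_exp b (f : {additive V -> {poly K}}) i t x : ode b f ->
  exp i t (@deriv K \o f) x =
    (cp b)%:P * exp i t (f \o D false) x + (c0 b)%:P * exp i t (f \o D true) x
    + (c1 b)%:P * 'X * exp i t (f \o e1) x
    + (c2 b)%:P * 'X ^+ 2 * exp i t (f \o e2) x
    + (c3 b)%:P * 'X ^+ 3 * exp i t (f \o e3) x
    + (c5 b)%:P * 'X ^+ 4 * exp i t (f \o e5) x.
Proof.
move=> fE; have [N DN] := nilopP (D i) x; pose E g := exp_actionE g (t%:P * 'X) DN.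
rewrite /exp (E (@deriv K \o f)) (E (f \o D false)) (E (f \o D true)).
rewrite (E (f \o e1)) (E (f \o e2)) (E (f \o e3)) (E (f \o e5)).
rewrite !mulr_sumr -!big_split; apply: eq_bigr => k _ /=.
by rewrite fE; move: (divpow _ _) => d; ring.
Qed.

Lemma exp_commute (es : seq (V -> V)) (f g : {additive V -> {poly K}}) i t x :
    (forall y, g y = f (nth (fun=> 0) es 0%N y)) ->
    (forall j y, (j < size es)%N -> D i (nth (fun=> 0) es j y) =
       nth (fun=> 0) es j (D i y) + nth (fun=> 0) es j.+1 y *+ j.+1) ->
  exp i t g x = \sum_(j < size es)
    (- (t%:P * 'X)) ^+ j * exp i t f (nth (fun=> 0) es j x).
Proof.
move=> gE eD; apply: exp_action_commute => //.
- exact: natX_unit.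
- move=> j y; have [/eD//|es_j] := ltnP j (size es).
  by rewrite !nth_default ?raddf0 ?mul0rn ?addr0 // (leq_trans es_j).
- by move=> j y es_j; rewrite nth_default.
Qed.

(** Appending a letter to a word acts on the coefficients of the differential
    equation as [lie_step] does on the logarithmic derivative of the matrix:
    only the commutation relations of the root vectors matter. *)
Lemma ode_step b (f : {additive V -> {poly K}}) (q : bool * K) :
  ode b f -> ode (lie_step b q) (exp q.1 q.2 f).
Proof.
case: q => i t fE x /=; rewrite {1}/exp deriv_exp_action //.
rewrite -!/(exp i t _) (ode_deriv_exp _ _ _ fE).
have self : exp i t (f \o D i) x = exp i t f (D i x).
  rewrite (@exp_commute [:: D i : V -> V] f _ _ t x) ?big_ord1 ?mul1r //.
  by case=> //= y _; rewrite mul0rn addr0.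
have -> : exp i t (f \o e5) x = exp i t f (e5 x).
  rewrite (@exp_commute [:: e5 : V -> V] f _ _ t x) ?big_ord1 ?mul1r //.
  by case=> //= y _; rewrite mul0rn addr0; case: (i); rewrite ?e05 ?e15.
case: b fE => p z0 z1 z2 z3 z5 _; case: i self => /= ->.
- have -> : exp true t (f \o D false) x =
      exp true t f (D false x) + t%:P * 'X * exp true t f (e1 x).
    rewrite (@exp_commute [:: D false : V -> V; fun y => - e1 y] f _ _ t x) //.
      by rewrite !big_ord_recl big_ord0 /= /exp raddfN /=; ring.
    by case=> [|[|//]] y _ /=; rewrite ?e01 ?raddfN ?e11 ?mul0rn; rewrite ?addrK ?addr0.
  have -> : exp true t (f \o e1) x = exp true t f (e1 x).
    rewrite (@exp_commute [:: e1 : V -> V] f _ _ t x) ?big_ord1 ?mul1r //.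
    by case=> //= y _; rewrite mul0rn addr0 e11.
  have -> : exp true t (f \o e2) x = exp true t f (e2 x).
    rewrite (@exp_commute [:: e2 : V -> V] f _ _ t x) ?big_ord1 ?mul1r //.
    by case=> //= y _; rewrite mul0rn addr0 e12.
  have -> : exp true t (f \o e3) x =
      exp true t f (e3 x) - t%:P * 'X * exp true t f (e5 x).
    rewrite (@exp_commute [:: e3 : V -> V; e5 : V -> V] f _ _ t x) //.
      by rewrite !big_ord_recl big_ord0 /= /exp; ring.
    by case=> [|[|//]] y _ /=; rewrite ?e13 ?e15 ?mul0rn ?addr0.
  by rewrite !(polyCD, polyCN, polyCM); ring.
have -> : exp false t (f \o D true) x =
    exp false t f (D true x) - t%:P * 'X * exp false t f (e1 x)
    + (t%:P * 'X) ^+ 2 * exp false t f (e2 x)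
    - (t%:P * 'X) ^+ 3 * exp false t f (e3 x).
  rewrite (@exp_commute
    [:: D true : V -> V; e1 : V -> V; e2 : V -> V; e3 : V -> V] f _ _ t x) //.
    by rewrite !big_ord_recl big_ord0 /= /exp; ring.
  by case=> [|[|[|[|//]]]] y _ /=; rewrite ?e01 ?e02 ?e03 ?e04 ?mul0rn ?addr0.
have -> : exp false t (f \o e1) x =
    exp false t f (e1 x) - 2 * t%:P * 'X * exp false t f (e2 x)
    + 3 * (t%:P * 'X) ^+ 2 * exp false t f (e3 x).
  rewrite (@exp_commute [:: e1 : V -> V; fun y => e2 y *+ 2; fun y => e3 y *+ 3] f _ _ t x) //.
    by rewrite !big_ord_recl big_ord0 /= /exp !raddfMn /=; ring.
  by case=> [|[|[|//]]] y _ /=;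
    rewrite ?raddfMn ?e02 ?e03 ?e04 ?mul0rn ?addr0 ?mulrnDl.
have -> : exp false t (f \o e2) x =
    exp false t f (e2 x) - 3 * t%:P * 'X * exp false t f (e3 x).
  rewrite (@exp_commute [:: e2 : V -> V; fun y => e3 y *+ 3] f _ _ t x) //.
    by rewrite !big_ord_recl big_ord0 /= /exp !raddfMn /=; ring.
  by case=> [|[|//]] y _ /=; rewrite ?raddfMn ?e03 ?e04 ?mul0rn ?addr0.
have -> : exp false t (f \o e3) x = exp false t f (e3 x).
  rewrite (@exp_commute [:: e3 : V -> V] f _ _ t x) ?big_ord1 ?mul1r //.
  by case=> //= y _; rewrite mul0rn addr0 e04.
by rewrite !(polyCD, polyCN, polyCM, polyC_exp, polyC1); ring.
Qed.

Lemma deriv_eq0 (p : {poly K}) : p^`() = 0 -> p = (p`_0)%:P.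
Proof.
move=> p0; apply/polyP => -[|n]; rewrite coefC //=.
have /eqP := congr1 (fun r : {poly K} => r`_n) p0.
by rewrite coef_deriv coef0 -mulr_natl mulf_eq0 (negPf (K0 n)) => /eqP.
Qed.

(** Replace every [t] by [t X]: the resulting polynomial solves the linear
    differential equation given by the Lie coordinates of the word, hence it
    is constant as soon as these coordinates vanish. *)
Lemma word_exp_trivial ty (iota : {additive V -> K}) l x :
    ((depth ty < 2)%N -> forall y, e2 y = 0) ->
    ((depth ty < 3)%N -> forall y, e3 y = 0 /\ e5 y = 0) ->
    liemx ty (lie_coord l) = 0 ->
  word_exp D iota l x = iota x.
Proof.
move=> e2_0 e35_0 /liemx_inj0[bp b0 b1 b2 b35].
pose lX := [seq (q.1, q.2%:P * 'X) | q <- l].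
pose f : {additive V -> {poly K}} := @polyC K \o iota.
pose F := word_exp D f lX.
have F_ode : ode (lie_coord l) F.
  have : ode (Coord 0 0 0 0 0 0) f.
    by move=> y; rewrite derivC /=; ring.
  rewrite /F /lX /lie_coord {bp b0 b1 b2 b35 F lX}.
  elim: l (Coord _ _ _ _ _ _) f => [|q l IHl] b f fE.
    exact: fE.
  exact/IHl/(ode_step q fE).
have {F_ode} F_const : F x = ((F x)`_0)%:P.
  apply: deriv_eq0; rewrite F_ode bp b0 b1 /= !mul0r !add0r.
  have -> : (c2 (lie_coord l))%:P * 'X ^+ 2 * F (e2 x) = 0.
    have [d2|/e2_0->] := ltnP 1 (depth ty); last by rewrite raddf0 mulr0.
    by rewrite b2 // !mul0r.
  have [d3|/e35_0/(_ x)[-> ->]] := ltnP 2 (depth ty).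
    by have [-> ->] := b35 d3; rewrite !mul0r !addr0.
  by rewrite raddf0 !mulr0 !addr0.
have F_eval a : (F x).[a] =
    word_exp D iota [seq (q.1, (q.2).[a]) | q <- lX] x.
  apply: (@rmorph_word_exp V D _ _
    (horner_eval a : {rmorphism {poly K} -> K}) f iota lX x) => [|y].
    exact: natX_unit.
  by rewrite /= /horner_eval hornerC.
have -> : l = [seq (q.1, (q.2).[1]) | q <- lX].
  rewrite -map_comp -[LHS]map_id; apply: eq_map => -[i t] /=.
  by rewrite hornerM hornerC hornerX mulr1.
(* At 1 the polynomial is the word, at 0 it is [iota]. *)
rewrite -F_eval; transitivity (F x).[0]; first by rewrite F_const !hornerC.
rewrite F_eval word_exp0 //.
by move=> q /mapP[_ /mapP[r _ ->] ->]; rewrite /= hornerM hornerX mulr0.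
Qed.

End RankTwoOperators.

(** * Extending ring morphisms to fractions *)

(** A fraction has a single possible image, which does not depend on the way it
    is written because [j] is injective. *)
Lemma fraction_extension (P X : comNzRingType) (L : comUnitRingType)
    (j : {rmorphism P -> X}) (f : {rmorphism P -> L}) :
    injective j ->
    (forall x, exists n d, x * j d = j n /\ f d \is a GRing.unit) ->
  exists F : {rmorphism X -> L}, forall p, F (j p) = f p.
Proof.
move=> j_inj frac.
pose is_val x y := exists n d,
  [/\ x * j d = j n, f d \is a GRing.unit & y * f d = f n].
have val_uniq x y z : is_val x y -> is_val x z -> y = z.
  move=> [n [d [xd du yd]]] [n' [d' [xd' du' zd']]].
  have /j_inj/(congr1 f) : j (n * d') = j (n' * d).
    by rewrite !rmorphM -xd -xd' mulrAC.
  rewrite !rmorphM -yd -zd' mulrAC => /(mulIr du).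
  by move=> /(mulIr du').
have /choice[F FP] : forall x, exists y, is_val x y.
  move=> x; have [n [d [xd du]]] := frac x.
  by exists (f n / f d), n, d; split=> //; rewrite divrK.
have F_eq x y : is_val x y -> F x = y by move=> /(val_uniq _ _ _ (FP x)).
have Fadd : zmod_morphism F.
  move=> x y; have [n [d [xd du Fx]]] := FP x.
  have [n' [d' [yd du' Fy]]] := FP y.
  apply: F_eq; exists (n * d' - n' * d), (d * d').
  rewrite !rmorphB !rmorphM unitrM du du' -xd -yd -Fx -Fy.
  by split=> //; ring.
have Fmul : monoid_morphism F.
  split=> [|x y]; first by apply: F_eq; exists 1, 1; rewrite !rmorph1 !mulr1 unitr1.
  have [n [d [xd du Fx]]] := FP x; have [n' [d' [yd du' Fy]]] := FP y.
  apply: F_eq; exists (n * n'), (d * d').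
  rewrite !rmorphM unitrM du du' -xd -yd -Fx -Fy.
  by split=> //; ring.
pose FF : {rmorphism X -> L} := HB.pack F
  (GRing.isZmodMorphism.Build _ _ F Fadd)
  (GRing.isMonoidMorphism.Build _ _ F Fmul).
by exists FF => p /=; apply: F_eq; exists p, 1; rewrite !rmorph1 !mulr1 unitr1.
Qed.

(** * Polynomials in arbitrarily many variables *)

Section Polynomials.
Variables (R : comNzRingType) (I : choiceType).
Local Notation poly := {malg R[{cmonom I}]}.

Lemma cmonom_ind (Pr : {cmonom I} -> Prop) :
    Pr mone -> (forall i m, Pr m -> Pr (mmul (ucm i) m)) ->
  forall m, Pr m.
Proof.
move=> Pr1 PrM m; have [n] := ubnP (mdeg m).
elim: n m => // n IHn m; rewrite ltnS => mn.
have [m0|m0] := eqVneq (mdeg m) 0%N; first by rewrite (mdeg_eq0I m0).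
have /fset0Pn[i im] : finsupp m != fset0.
  by apply: contraNneq m0 => m0; rewrite mdegE m0 big_seq_fset0.
have mE : m = mmul (ucm i) (divcm m (ucm i)).
  apply/eqP/cmP => k; rewrite cmM divcmE cmU.
  have [<-|_] := eqVneq i k; last by rewrite add0n subn0.
  by rewrite addnC subnK // lt0n cmE_neq0.
rewrite mE; apply/PrM/IHn; move: mn; rewrite {1}mE mdegM mdegU.
by rewrite add1n.
Qed.

Lemma malg_ind (Pr : poly -> Prop) :
    (forall c, Pr c%:MP) -> (forall i, Pr << ucm i >>) ->
    (forall p q, Pr p -> Pr q -> Pr (p + q)) ->
    (forall p q, Pr p -> Pr q -> Pr (p * q)) ->
  forall p, Pr p.
Proof.
move=> PrC PrX PrD PrM p; rewrite [p]monalgE.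
have PrU m : Pr << m >>.
  elim/cmonom_ind: m => [|i m IHm]; first exact: PrC.
  have e : << mmul (ucm i) m >> = << ucm i >> * << m >> :> poly.
    by rewrite malgM_def fgmulUU mulr1.
  by rewrite e; exact: PrM (PrX i) IHm.
elim/big_rec: _ => [|m q _ Prq]; first by rewrite -malgC0E.
have e : << p@_m *g m >> = (p@_m)%:MP * << m >>.
  by rewrite malgM_def fgmulUU mulr1 mul1m.
by apply: PrD Prq; rewrite e; exact: PrM (PrC _) (PrU m).
Qed.

Lemma malg_rmorph_ext (L : nzRingType) (F G : {rmorphism poly -> L}) :
    (forall c, F c%:MP = G c%:MP) ->
    (forall i, F << ucm i >> = G << ucm i >>) -> F =1 G.
Proof.
move=> FGC FGX; elim/malg_ind => // p q Fp Fq; first by rewrite !rmorphD Fp Fq.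
by rewrite !rmorphM Fp Fq.
Qed.

Section Evaluation.
Variables (L : comNzRingType) (g : I -> L).

Definition monom_eval (m : {cmonom I}) : L := \prod_(i <- finsupp m) g i ^+ m i.

Lemma monom_evalE (d : {fset I}) (m : {cmonom I}) : (finsupp m `<=` d)%fset ->
  monom_eval m = \prod_(i <- d) g i ^+ m i.
Proof.
move=> md; apply: big_fset_incl => // i _; rewrite -cmE_eq0 => /eqP ->.
by rewrite expr0.
Qed.

Lemma monom_eval_morph : mmorphism monom_eval.
Proof.
split=> [m m'|]; last by rewrite /monom_eval mdom1 big_seq_fset0.
rewrite (monom_evalE (fsubsetUl (finsupp m) (finsupp m'))).
rewrite (monom_evalE (fsubsetUr (finsupp m) (finsupp m'))).
rewrite /monom_eval mdomD -big_split; apply: eq_bigr => i _ /=.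
by rewrite cmM exprD.
Qed.

HB.instance Definition _ :=
  isMultiplicative.Build {cmonom I} L monom_eval monom_eval_morph.

Lemma monom_evalU i : monom_eval (ucm i) = g i.
Proof. by rewrite /monom_eval mdomU big_seq_fset1 cmUU expr1. Qed.

Lemma malg_extension (f : {rmorphism R -> L}) :
  exists F : {rmorphism poly -> L},
    (forall c, F c%:MP = f c) /\ (forall i, F << ucm i >> = g i).
Proof.
exists (mmap f monom_eval : {rmorphism poly -> L}); split=> [c|i] /=.
  by rewrite mmapC.
by rewrite mmapU /= monom_evalU [f 1](rmorph1 f) mul1r.
Qed.

End Evaluation.

End Polynomials.

Lemma fraction_numden (D : idomainType) (x : {fraction D}) :
  exists n d, x * FracField.tofrac d = FracField.tofrac n /\ d != 0.
Proof.
elim/quotW: x => r; exists (\n_r), (\d_r); split; last exact: denom_ratioP.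
unlock FracField.tofrac; rewrite -[LHS]FracField.pi_mul; apply/eqP.
rewrite eqmodE /= FracField.equivfE /FracField.mulf.
by rewrite !numden_Ratio ?(oner_eq0, mulf_neq0, denom_ratioP) // !mulr1 mulrC.
Qed.

(** * Rational functions and Laurent polynomials *)

Section PolyFrac.
Variables (R : idomainType) (I : choiceType).

Lemma polyFrac_fraction (x : polyFrac R I) :
  exists n d, x * polyFracP d = polyFracP n /\ d != 0.
Proof.
by rewrite polyFracP.unlock; exact: fraction_numden.
Qed.

Lemma polyFrac_rmorph_ext (L : comUnitRingType) (F G : {rmorphism polyFrac R I -> L}) :
    (forall c, F (polyFracC I c) = G (polyFracC I c)) ->
    (forall i, F (polyFracX R i) = G (polyFracX R i)) -> F =1 G.
Proof.
move=> FGC FGX x.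
have FGP p : F (polyFracP p) = G (polyFracP p).
  apply: (malg_rmorph_ext (F := (F \o @polyFracP R I : {rmorphism _ -> _}))
                         (G := (G \o @polyFracP R I : {rmorphism _ -> _}))) => [c|i] /=.
    by have := FGC c; rewrite polyFracC.unlock.
  by have := FGX i; rewrite polyFracX.unlock.
have [n [d [xd d0]]] := polyFrac_fraction x.
have du : F (polyFracP d) \is a GRing.unit.
  by rewrite rmorph_unit // unitfE polyFracP_eq0.
by apply: (mulIr du); rewrite [in RHS]FGP -!rmorphM xd FGP.
Qed.

End PolyFrac.

Section LaurentRing.
Variables (F : idomainType) (I : choiceType).

Definition laurent_of_poly (p : {malg F[{cmonom I}]}) : laurent F I :=
  Laurent (laurent_poly p).

Lemma laurent_of_poly_zmod : zmod_morphism laurent_of_poly.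
Proof. by move=> p q; apply/val_inj; rewrite /= !rmorphB. Qed.

Lemma laurent_of_poly_monoid : monoid_morphism laurent_of_poly.
Proof. by split=> [|p q]; apply/val_inj; rewrite /= ?rmorph1 ?rmorphM. Qed.

HB.instance Definition _ := GRing.isZmodMorphism.Build
  {malg F[{cmonom I}]} (laurent F I) laurent_of_poly laurent_of_poly_zmod.
HB.instance Definition _ := GRing.isMonoidMorphism.Build
  {malg F[{cmonom I}]} (laurent F I) laurent_of_poly laurent_of_poly_monoid.

Lemma laurent_of_polyC c : laurent_of_poly c%:MP = laurentC I c.
Proof. by rewrite laurentC.unlock. Qed.

Lemma laurent_of_polyX i : laurent_of_poly << ucm i >> = laurentX F i.
Proof. by rewrite laurentX.unlock. Qed.

Lemma laurent_of_poly_inj : injective laurent_of_poly.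
Proof.
move=> p q /(congr1 val) /= /eqP; rewrite -subr_eq0 -rmorphB polyFracP_eq0.
by rewrite subr_eq0 => /eqP.
Qed.

Lemma laurent_fraction (x : laurent F I) : exists p m,
  x * laurent_of_poly << m >> = laurent_of_poly p.
Proof.
have /asboolP[p [m xm]] := laurentP x; exists p, m.
by apply/val_inj; rewrite rmorphM.
Qed.

Lemma monom_unit (L : comUnitRingType) (G : {rmorphism {malg F[{cmonom I}]} -> L})
    (m : {cmonom I}) :
  (forall i, G << ucm i >> \is a GRing.unit) -> G << m >> \is a GRing.unit.
Proof.
move=> GX; elim/cmonom_ind: m => [|i m IHm]; first by rewrite [G _]rmorph1 unitr1.
have e : G << mmul (ucm i) m >> = G << ucm i >> * G << m >>.
  by rewrite -rmorphM; congr (G _); exact: malgUM.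
apply: (eq_ind_r (fun y : L => y \is a GRing.unit) _ e).
have uM := unitrM (G << ucm i >>) (G << m >>).
by apply: (eq_ind_r is_true _ uM); apply/andP; split; [exact: GX | exact: IHm].
Qed.

Lemma laurent_rmorph_ext (L : comUnitRingType) (G H : {rmorphism laurent F I -> L}) :
    (forall c, G (laurentC I c) = H (laurentC I c)) ->
    (forall i, G (laurentX F i) = H (laurentX F i)) -> G =1 H.
Proof.
move=> GHC GHX x.
pose lp : {rmorphism _ -> _} := laurent_of_poly.
have GHP p : G (lp p) = H (lp p).
  apply: (malg_rmorph_ext (F := (G \o lp : {rmorphism _ -> _}))
                         (G := (H \o lp : {rmorphism _ -> _}))) => [c|i] /=.
    by rewrite /lp /= laurent_of_polyC GHC.
  by rewrite /lp /= laurent_of_polyX GHX.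
have [p [m xm]] := laurent_fraction x.
have mu : G (lp << m >>) \is a GRing.unit.
  apply: (monom_unit (G := (G \o lp : {rmorphism _ -> _}))) => i /=.
  by rewrite /lp /= laurent_of_polyX rmorph_unit ?laurentX_unit.
by apply: (mulIr mu); rewrite [in RHS]GHP -!rmorphM xm GHP.
Qed.

Lemma laurent_extension (L : comUnitRingType) (f : {rmorphism F -> L}) (g : I -> L) :
    (forall i, g i \is a GRing.unit) ->
  exists G : {rmorphism laurent F I -> L},
    (forall c, G (laurentC I c) = f c) /\ (forall i, G (laurentX F i) = g i).
Proof.
move=> gu; have [G0 [G0C G0X]] := malg_extension g f.
have [|G GE] := fraction_extension (f := G0) laurent_of_poly_inj.
  move=> x; have [p [m xm]] := laurent_fraction x; exists p, << m >>.
  by split=> //; apply: monom_unit => i; rewrite G0X.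
exists G; split=> [c|i]; first by rewrite -laurent_of_polyC GE G0C.
by rewrite -laurent_of_polyX GE G0X.
Qed.

End LaurentRing.

(** * Poisson algebras *)

Section Poisson.
Variables (k : numFieldType) (A : poissonAlgType k).
Implicit Types f g h : A.

HB.instance Definition _ f :=
  GRing.isLinear.Build k A A *:%R (bracket f) (bracket_linearr f).

Lemma bracketZl c f g : bracket (c *: f) g = c *: bracket f g.
Proof. by rewrite bracketC linearZ -scalerN -(bracketC f g). Qed.

Lemma bracketNl f g : bracket (- f) g = - bracket f g.
Proof. by rewrite bracketC raddfN -(bracketC f g). Qed.

Lemma bracketff f : bracket f f = 0.
Proof.
have /eqP := bracketC f f; rewrite -addr_eq0 -mulr2n -scaler_nat scaler_eq0.
by rewrite pnatr_eq0 => /eqP.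
Qed.

Lemma bracket_bracket f g h :
  bracket f (bracket g h) = bracket g (bracket f h) + bracket (bracket f g) h.
Proof.
have := bracket_jacobi f g h => /eqP.
rewrite (bracketC h f) raddfN [X in _ + X]bracketC => /eqP /(canRL (subrK _)).
by rewrite add0r => /(canRL (subrK _)) ->; rewrite addrC.
Qed.

(** The elements killed by a power of a derivation of both the product and the
    bracket form a Poisson subalgebra. *)
Lemma nilop_generated (I : Type) (phi : I -> A) g :
    poisson_generated phi ->
    (forall i, exists N, iter N (bracket g) (phi i) = 0) ->
  forall f, exists N, iter N (bracket g) f = 0.
Proof.
move=> gen nil_phi f; pose S : {pred A} :=
  fun f => `[< exists N, iter N (bracket g) f = 0 >].
suff /asboolP : f \in S by [].
apply: gen => [|f1 f2 /asboolP[n fn] /asboolP[m fm]|i]; last exact/asboolP.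
- split.
  + apply/asboolP; exists 1%N => /=.
    have := bracketMr g 1 1; rewrite !mul1r mulr1 => /eqP.
    by rewrite -subr_eq subrr eq_sym => /eqP.
  + move=> c f1 f2 /asboolP[n fn] /asboolP[m fm]; apply/asboolP.
    exists (maxn n m).
    have f1n := iter_nil (leq_maxl n m) fn; have f2m := iter_nil (leq_maxr n m) fm.
    have iterZ l h : iter l (bracket g) (c *: h) = c *: iter l (bracket g) h.
      by elim: l => //= l ->; rewrite linearZ.
    have /= -> : c *: f1 + f2 = c *: f1 - (- f2) by rewrite opprK.
    rewrite iter_additive iterZ f1n scaler0 sub0r -[- f2]sub0r iter_additive.
    by rewrite f2m iter0l subr0 oppr0.
  + move=> f1 f2 /asboolP[n fn] /asboolP[m fm]; apply/asboolP.
    exists (n + m)%N; apply: iter_nil_op => //.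
    * by move=> h x y; rewrite mulrBl.
    * by move=> h x y; rewrite mulrBr.
    * exact: bracketMr.
apply/asboolP; exists (n + m)%N; apply: iter_nil_op => //.
- by move=> h x y; rewrite bracketC raddfB opprB addrC (bracketC x) (bracketC y) opprK.
- by move=> h; exact: raddfB.
by move=> x y; rewrite /= (bracket_bracket g) addrC.
Qed.

End Poisson.

(** * The reflections on the field of fractions *)

Section WeylAction.
Variables (k : numFieldType) (I : choiceType) (a : I -> I -> int).
Variables (A0 : poissonDomainType k) (phi : I -> A0).
Hypothesis a_gcm : is_gcm a.
Hypothesis phi_neq0 : forall i, phi i != 0.
Hypothesis phi_gen : poisson_generated phi.
Hypothesis phi_serre : forall i j, i != j ->
  iter (absz (- a i j + 1)) (bracket (phi i)) (phi j) = 0.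

Local Notation K := (polyFrac A0 I).
Local Notation X := (polyFracX A0).
Local Notation C := (@polyFracC A0 I).

Lemma polyFracC_eq0 (f : A0) : (C f == 0) = (f == 0).
Proof. by rewrite polyFracC.unlock polyFracP_eq0 -malgC0E malgC_eq. Qed.

Lemma poisson_natr_neq0 n : n.+1%:R != 0 :> A0.
Proof. by rewrite -scaler_nat scaler_eq0 oner_eq0 pnatr_eq0. Qed.

Lemma polyFrac_natr_neq0 n : n.+1%:R != 0 :> K.
Proof. by rewrite -(rmorph_nat C) polyFracC_eq0 poisson_natr_neq0. Qed.

Lemma polyFrac_natr_unit n : n.+1%:R \is a @GRing.unit K.
Proof. by rewrite unitfE polyFrac_natr_neq0. Qed.

Lemma Cphi_neq0 i : C (phi i) != 0.
Proof. by rewrite polyFracC_eq0. Qed.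

Lemma bracket_phi_nil i f : exists N, iter N (bracket (phi i)) f = 0.
Proof.
apply: (nilop_generated phi_gen) => j.
have [<-|ij] := eqVneq i j; first by exists 1%N; rewrite /= bracketff.
by exists (absz (- a i j + 1)); apply: phi_serre.
Qed.

Definition ad_phi i : nilop A0 :=
  @NilOp A0 (bracket (phi i) : {additive A0 -> A0}) (bracket_phi_nil i).

Definition lam_phi i : K := X i / C (phi i).

Definition exp_phi i : A0 -> K := exp_action (ad_phi i) C (lam_phi i).

Lemma exp_phi_zmod i : zmod_morphism (exp_phi i).
Proof. exact: raddfB. Qed.

Lemma exp_phi_monoid i : monoid_morphism (exp_phi i).
Proof.
split=> [|f g]; last first.
  by apply: exp_actionM => [n|x y /=]; [exact: polyFrac_natr_unit | rewrite bracketMr].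
rewrite /exp_phi (@exp_actionE _ _ _ _ _ _ 1).
  by rewrite big_ord1 divpow0 mul1r /= rmorph1.
have /= := bracketMr (phi i) 1 1; rewrite !mul1r mulr1 => /eqP.
by rewrite -subr_eq subrr eq_sym => /eqP.
Qed.

HB.instance Definition _ i :=
  GRing.isZmodMorphism.Build A0 K (exp_phi i) (exp_phi_zmod i).
HB.instance Definition _ i :=
  GRing.isMonoidMorphism.Build A0 K (exp_phi i) (exp_phi_monoid i).

Lemma exp_phi_phi i : exp_phi i (phi i) = C (phi i).
Proof.
rewrite /exp_phi (@exp_actionE _ _ _ _ _ _ 1) /= ?bracketff //.
by rewrite big_ord1 divpow0 mul1r.
Qed.

(** The reflection negates the parameter [lambda i / phi i] of its own
    exponential, so that applying it twice composes two inverse exponentials. *)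
Lemma weyl_involutive i (s : {rmorphism K -> K}) :
    (forall f, s (C f) = exp_phi i f) ->
    (forall j, s (X j) = X j - (a j i)%:~R * X i) ->
  involutive s.
Proof.
move=> sC sX; have [aii _ _ _] := a_gcm.
have sXi : s (X i) = - X i by rewrite sX aii; ring.
have st : s (lam_phi i) = - lam_phi i.
  by rewrite rmorphM fmorphV sXi sC exp_phi_phi mulNr.
apply: (polyFrac_rmorph_ext (F := (s \o s : {rmorphism _ -> _}))
          (G := (idfun : {rmorphism _ -> _}))) => [f|j] /=.
  rewrite sC /exp_phi (rmorph_exp_action _ C s _ _ polyFrac_natr_unit) st.
  rewrite (exp_action_ext _ _ _ (g := exp_action (ad_phi i) C (lam_phi i))).
    exact: (exp_actionNK polyFrac_natr_unit).
  exact: sC.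
by rewrite sX rmorphB rmorphM rmorph_int sXi sX; ring.
Qed.

Lemma additive_scale_natV (G : {additive A0 -> K}) (n : nat) (f : A0) :
  (0 < n)%N -> G (n%:R^-1 *: f) = n%:R^-1 * G f.
Proof.
case: n => // n _; apply: (mulfI (polyFrac_natr_neq0 n)).
rewrite mulrA mulfV ?polyFrac_natr_neq0 //.
rewrite mul1r mulr_natl -raddfMn -scaler_nat scalerA mulfV ?scale1r //.
by rewrite pnatr_eq0.
Qed.

Lemma clear_denominator (F : fieldType) (c w v x z : F) :
  v != 0 -> c * (w * z) * x = w * v * (c * (x / v) * z).
Proof. by move=> v0; field. Qed.

Lemma clear_denominator_add (P : nzRingType) (F : comNzRingType)
    (f g : {rmorphism P -> F}) u w N M p q p' q' :
    f u = w -> f p' = w ^+ N * g p -> f q' = w ^+ M * g q ->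
  f (u ^+ M * p' + u ^+ N * q') = w ^+ (N + M) * g (p + q).
Proof.
move=> fu fp fq.
by rewrite !rmorphD !rmorphM !rmorphXn fu fp fq exprD; ring.
Qed.

Lemma clear_denominator_mul (P : nzRingType) (F : comNzRingType)
    (f g : {rmorphism P -> F}) w N M p q p' q' :
    f p' = w ^+ N * g p -> f q' = w ^+ M * g q ->
  f (p' * q') = w ^+ (N + M) * g (p * q).
Proof. by move=> fp fq; rewrite !rmorphM fp fq exprD mulrACA. Qed.

(** The equations on the arguments are hypotheses here, so that two explicit
    polynomials are never compared by unfolding their representation. *)
Lemma rmorphMXnE (R S : nzRingType) (f : {rmorphism R -> S}) x y x' y' n :
  f x = x' -> f y = y' -> f (x * y ^+ n) = x' * y' ^+ n.
Proof. by move=> <- <-; rewrite rmorphM rmorphXn. Qed.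

Lemma rmorph_subzE (R S : nzRingType) (f : {rmorphism R -> S}) x y x' y'
    (z : int) :
  f x = x' -> f y = y' -> f (x - z%:~R * y) = x' - z%:~R * y'.
Proof. by move=> <- <-; rewrite rmorphB rmorphM rmorph_int. Qed.

(** Clearing denominators in [sigma p] and applying [sigma] again gives back
    [p], up to the same denominator. *)
Lemma weyl_clear_denominators i
    (emb sigma : {rmorphism {malg A0[{cmonom I}]} -> K}) :
    (forall f, emb f%:MP = C f) -> (forall j, emb << ucm j >> = X j) ->
    (forall f, sigma f%:MP = exp_phi i f) ->
    (forall j, sigma << ucm j >> = X j - (a j i)%:~R * X i) ->
  forall p, exists N q, emb q = C (phi i) ^+ N * sigma p /\
    sigma q = C (phi i) ^+ N * emb p.
Proof.
move=> PC PX sC sX; have [aii _ _ _] := a_gcm.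
have sXi : sigma << ucm i >> = - X i by rewrite sX aii; ring.
have sphi : sigma (phi i)%:MP = C (phi i) by rewrite sC exp_phi_phi.
have Pphi : emb (phi i)%:MP = C (phi i) by [].
elim/malg_ind => [f|j|p q [N [p' [Pp' sp']]] [M [q' [Pq' sq']]]|
                        p q [N [p' [Pp' sp']]] [M [q' [Pq' sq']]]].
- have [N fN] := nilopP (ad_phi i) f; exists N.
  pose c n := n`!%:R^-1 *: (phi i ^+ (N - n) * iter n (ad_phi i) f).
  exists (\sum_(n < N) (c n)%:MP * << ucm i >> ^+ n).
  have phiN (n : 'I_N) : C (phi i) ^+ N = C (phi i) ^+ (N - n) * C (phi i) ^+ n.
    by rewrite -exprD subnK // ltnW.
  have phi_u n : C (phi i) ^+ n != 0 by rewrite expf_neq0 ?Cphi_neq0.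
  rewrite (sC f) /exp_phi (PC f) (exp_actionE _ _ fN) !rmorph_sum !mulr_sumr; split.
    apply: eq_bigr => n _; rewrite (rmorphMXnE _ (PC (c n)) (PX i)) /c.
    rewrite (additive_scale_natV C) ?fact_gt0 //=.
    rewrite rmorphM rmorphXn.
    rewrite (phiN n) /divpow /lam_phi.
    by rewrite expr_div_n; apply: clear_denominator.
  transitivity (C (phi i) ^+ N * exp_action (ad_phi i) (exp_phi i) (- lam_phi i) f).
    rewrite (exp_actionE _ _ fN) mulr_sumr; apply: eq_bigr => n _.
    rewrite (rmorphMXnE _ (sC (c n)) sXi) /c.
    rewrite (additive_scale_natV (exp_phi i)) ?fact_gt0 //=.
    rewrite rmorphM rmorphXn /= exp_phi_phi.
    rewrite (phiN n) /divpow /lam_phi -[- (_ / _)]mulNr.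
    by rewrite expr_div_n; apply: clear_denominator.
  by congr (_ * _); exact: (exp_actionNK polyFrac_natr_unit).
- exists 0%N, (<< ucm j >> - (a j i)%:~R * << ucm i >>).
  rewrite (rmorph_subzE _ (PX j) (PX i)) (rmorph_subzE _ (sX j) sXi) (sX j).
  by rewrite (PX j) expr0 !mul1r; split=> //; ring.
- exists (N + M)%N, ((phi i)%:MP ^+ M * p' + (phi i)%:MP ^+ N * q').
  by split; [apply: (clear_denominator_add Pphi)
            | apply: (clear_denominator_add sphi)].
by exists (N + M)%N, (p' * q'); split; apply: clear_denominator_mul.
Qed.

Lemma weyl_extension i : exists s : {rmorphism K -> K},
  (forall f, s (C f) = exp_phi i f) /\
  (forall j, s (X j) = X j - (a j i)%:~R * X i).
Proof.
have [sigma [sC sX]] := malg_extension (fun j => X j - (a j i)%:~R * X i) (exp_phi i).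
have P_inj : injective (@polyFracP A0 I).
  move=> p q /eqP; rewrite -subr_eq0 -rmorphB polyFracP_eq0 subr_eq0.
  by move/eqP.
have [|s sE] := fraction_extension (f := sigma) P_inj.
  move=> x; have [n [d [xd d0]]] := polyFrac_fraction x; exists n, d.
  split=> //; rewrite unitfE; apply: contra_neq d0 => sd0.
  have PC f : polyFracP f%:MP = C f by rewrite polyFracC.unlock.
  have PX (j : I) : polyFracP << ucm j >> = X j by rewrite polyFracX.unlock.
  have [N [q []]] := weyl_clear_denominators PC PX sC sX d; rewrite sd0 mulr0 => /eqP.
  rewrite polyFracP_eq0 => /eqP ->; rewrite rmorph0 => /esym/eqP.
  by rewrite mulf_eq0 expf_eq0 (negPf (Cphi_neq0 i)) andbF polyFracP_eq0 => /eqP.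
exists s; split=> [f|j].
  by rewrite -sC -sE polyFracC.unlock.
by rewrite -sX -sE polyFracX.unlock.
Qed.

Lemma weyl_on_K_exists : exists s : I -> {rmorphism K -> K}, is_weyl_on_K a phi s.
Proof.
have /choice[s sP] := weyl_extension; exists s => i; have [sC sX] := sP i.
by split=> //; have sK := weyl_involutive sC sX; exists (s i).
Qed.

End WeylAction.

(** * The tau-functions *)

Section Tau.
Variables (K : fieldType) (I : choiceType) (a : I -> I -> int).
Hypothesis a_gcm : is_gcm a.
Local Notation L := (laurent K I).
Local Notation tau := (@laurentX K I).
Local Notation C := (@laurentC K I).

Definition tau_root i : L :=
  \big[*%R/1]_(k \in [set: I]%classic) tau k ^ (- a k i).

Lemma tau_unit i : tau i \is a GRing.unit.
Proof. exact: laurentX_unit. Qed.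

(** By local finiteness the product is a finite one.  It is split into the
    factors at some prescribed indices and a remainder [rho], for later use with
    morphisms that move the tau-functions at these indices only. *)
Lemma tau_root_split i (ds : seq I) : uniq ds -> exists rho,
  [/\ rho \is a GRing.unit,
      tau_root i = \prod_(k <- ds) tau k ^ (- a k i) * rho
    & forall G : {rmorphism L -> L},
        (forall k, k \notin ds -> G (tau k) = tau k) -> G rho = rho].
Proof.
move=> uds; have [_ _ a0 /(_ i)/finite_seqP[r ar]] := a_gcm.
pose r' := undup (r ++ ds).
exists (\prod_(k <- r' | k \notin ds) tau k ^ (- a k i)); split.
- by apply: rpred_prod => k _; rewrite unitrXz ?tau_unit.
- rewrite /tau_root (fsbigE r') ?undup_uniq //; last first.
    move=> k _; rewrite mem_undup mem_cat negb_or => /andP[kr _].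
    suff /eqP -> : a k i == 0 by [].
    apply: contraNT kr => aki; have : [set j | a i j != 0]%classic k.
      by apply: contra_neq aki => /a0.
    by rewrite ar.
  rewrite (bigID (mem ds)) /=; congr (_ * _); last first.
    by apply: eq_bigl => k; rewrite in_setT.
  under eq_bigl do rewrite in_setT /=.
  rewrite -big_filter; apply: perm_big; apply: uniq_perm => //.
    by rewrite filter_uniq ?undup_uniq.
  by move=> k; rewrite mem_filter mem_undup mem_cat; case: (k \in ds); rewrite ?orbT.
move=> G Gtau; rewrite rmorph_prod; apply: eq_bigr => k kds.
by rewrite rmorphXz ?Gtau ?tau_unit.
Qed.

Variables (s : I -> {rmorphism K -> K}) (phi : I -> K).
Hypothesis phi_neq0 : forall i, phi i != 0.
Hypothesis s_phi : forall i, s i (phi i) = phi i.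
Hypothesis s_inv : forall i, involutive (s i).

Lemma laurentC_unit x : x != 0 -> C x \is a GRing.unit.
Proof. by move=> x0; rewrite rmorph_unit ?unitfE. Qed.

Lemma tau_root_unit i : tau_root i \is a GRing.unit.
Proof.
have [rho [rho_u -> _]] := tau_root_split i (isT : uniq [::]).
by rewrite big_nil mul1r.
Qed.

Lemma tau_involutive i (S : {rmorphism L -> L}) :
    (forall x, S (C x) = C (s i x)) ->
    (forall j, i != j -> S (tau j) = tau j) ->
    S (tau i) = C (phi i) * tau i * tau_root i ->
  involutive S.
Proof.
move=> SC Stau Staui; have [aii _ _ _] := a_gcm.
have [rho [rho_u rootE S_rho]] := tau_root_split i (isT : uniq [:: i]).
have Srho : S rho = rho.
  by apply: S_rho => j; rewrite inE eq_sym => /Stau.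
have {}Staui : S (tau i) = C (phi i) * rho / tau i.
  rewrite Staui rootE big_seq1 aii -[(- 2)%R]/(- 2%:Z) -exprnN.
  rewrite expr2 invrM ?tau_unit // !mulrA mulrK ?tau_unit //.
  by rewrite -!mulrA; congr (_ * _); rewrite mulrC.
have u_unit : C (phi i) * rho \is a GRing.unit by rewrite unitrM laurentC_unit.
apply: (laurent_rmorph_ext (G := (S \o S : {rmorphism _ -> _}))
          (H := (idfun : {rmorphism _ -> _}))) => [x|j] /=.
  by rewrite !SC s_inv.
have [<-|ij] := eqVneq i j; last by rewrite !Stau.
rewrite Staui rmorph_div ?tau_unit // Staui rmorphM SC s_phi Srho.
by rewrite invrM ?unitrV ?tau_unit // invrK mulrCA divrr ?mulr1.
Qed.

Lemma tau_extension_exists i : exists S : {rmorphism L -> L},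
  [/\ bijective S, forall x, S (C x) = C (s i x),
      forall j, i != j -> S (tau j) = tau j
    & S (tau i) = C (phi i) * tau i * tau_root i].
Proof.
pose g j : L := if i == j then C (phi i) * tau i * tau_root i else tau j.
have g_unit j : g j \is a GRing.unit.
  rewrite /g; case: ifP => _; last exact: tau_unit.
  by rewrite !unitrM laurentC_unit // tau_unit tau_root_unit.
have [S [SC SX]] := laurent_extension (C \o s i : {rmorphism K -> L}) g_unit.
have Stau j : i != j -> S (tau j) = tau j by rewrite SX /g => /negPf ->.
have Staui : S (tau i) = C (phi i) * tau i * tau_root i by rewrite SX /g eqxx.
exists S; split=> //.
by have SK := tau_involutive SC Stau Staui; exists S.
Qed.

End Tau.

(** * The Serre relations in rank two *)

Section SerreRelations.
Variables (k : numFieldType) (A : poissonAlgType k) (f g : A).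
Hypotheses (serre_fg : iter 4 (bracket f) g = 0)
           (serre_gf : iter 2 (bracket g) f = 0).

Let w1 := bracket f g.
Let w2 := bracket f w1.
Let w3 := bracket f w2.
Let w5 := bracket g w3.

(** The iterated brackets of two generators, divided by factorials so that they
    are divided powers applied to the long one. *)
Definition root_coord : coord A :=
  Coord f g w1 (2^-1 *: w2) (6^-1 *: w3) (6^-1 *: w5).

Let gf : bracket g f = - w1. Proof. by rewrite bracketC. Qed.

Let gw1 : bracket g w1 = 0.
Proof. by have := serre_gf; rewrite /= gf raddfN => /eqP; rewrite oppr_eq0 => /eqP. Qed.

Let gw2 : bracket g w2 = 0.
Proof.
by rewrite bracket_bracket gf gw1 raddf0 add0r bracketNl bracketff oppr0.
Qed.

Let w5E : w5 = - bracket w1 w2.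
Proof.
have /eqP := bracket_bracket f g w2; rewrite gw2 raddf0 eq_sym addr_eq0.
by move/eqP.
Qed.

Let fw5_w1w3 : bracket f w5 = bracket w1 w3.
Proof. by rewrite bracket_bracket [bracket f w3]serre_fg raddf0 add0r. Qed.

Let fw5 : bracket f w5 = 0.
Proof.
(* Expanding the bracket by [w5E] gives the opposite of [fw5_w1w3]. *)
have : bracket f w5 = - bracket f w5.
  rewrite {1}w5E raddfN /= (bracket_bracket f w1) -/w2 bracketff addr0.
  by rewrite fw5_w1w3.
move/eqP; rewrite -addr_eq0 -mulr2n -scaler_nat scaler_eq0 pnatr_eq0.
by move/eqP.
Qed.

Let gw5 : bracket g w5 = 0.
Proof.
by rewrite w5E raddfN /= (bracket_bracket g w1) gw1 gw2 raddf0 add0r bracketC raddf0 !oppr0.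
Qed.

(** These are the relations of the nilpotent part of G2 in the adjoint
    action: by the Jacobi identity the two Serre relations leave no brackets
    beyond those of [root_coord]. *)
Lemma bracket_root_coord x (c := root_coord) :
  [/\ bracket f (bracket g x) = bracket g (bracket f x) + bracket (c1 c) x,
      bracket f (bracket (c1 c) x) =
        bracket (c1 c) (bracket f x) + bracket (c2 c) x *+ 2,
      bracket f (bracket (c2 c) x) =
        bracket (c2 c) (bracket f x) + bracket (c3 c) x *+ 3,
      bracket f (bracket (c3 c) x) = bracket (c3 c) (bracket f x)
    & bracket f (bracket (c5 c) x) = bracket (c5 c) (bracket f x)] /\
  [/\ bracket g (bracket (c1 c) x) = bracket (c1 c) (bracket g x),
      bracket g (bracket (c2 c) x) = bracket (c2 c) (bracket g x),
      bracket g (bracket (c3 c) x) =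
        bracket (c3 c) (bracket g x) + bracket (c5 c) x
    & bracket g (bracket (c5 c) x) = bracket (c5 c) (bracket g x)].
Proof.
have fw3 : bracket f w3 = 0 by exact: serre_fg.
rewrite /c /=; split; split.
- by rewrite bracket_bracket.
- rewrite bracket_bracket -/w2 bracketZl -scaler_nat scalerA divff ?scale1r //.
  by rewrite pnatr_eq0.
- rewrite bracket_bracket linearZ /= -/w3 !bracketZl -scaler_nat scalerA.
  by congr (_ + _ *: _); field; rewrite ?pnatr_eq0.
- by rewrite bracket_bracket linearZ /= fw3 scaler0 [bracket 0 _]bracketC raddf0 oppr0 addr0.
- by rewrite bracket_bracket linearZ /= fw5 scaler0 [bracket 0 _]bracketC raddf0 oppr0 addr0.
- by rewrite bracket_bracket gw1 [bracket 0 _]bracketC raddf0 oppr0 addr0.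
- by rewrite bracket_bracket linearZ /= gw2 scaler0 [bracket 0 _]bracketC raddf0 oppr0 addr0.
- by rewrite bracket_bracket linearZ /= -/w5.
- by rewrite bracket_bracket linearZ /= gw5 scaler0 [bracket 0 _]bracketC raddf0 oppr0 addr0.
Qed.

Lemma root_coord_table (c := root_coord) :
  [/\ bracket f g = c1 c, bracket f (c1 c) = c2 c *+ 2,
      bracket f (c2 c) = c3 c *+ 3, bracket f (c3 c) = 0
    & bracket f (c5 c) = 0] /\
  [/\ bracket g f = - c1 c, bracket g (c1 c) = 0,
      bracket g (c2 c) = 0, bracket g (c3 c) = c5 c & bracket g (c5 c) = 0].
Proof.
have fw3 : bracket f w3 = 0 by exact: serre_fg.
rewrite /c /=; split; split=> //.
- by rewrite -/w2 -scaler_nat scalerA divff ?scale1r ?pnatr_eq0.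
- rewrite linearZ /= -/w3 -scaler_nat scalerA.
  by congr (_ *: _); field; rewrite ?pnatr_eq0.
- by rewrite linearZ /= fw3 scaler0.
- by rewrite linearZ /= fw5 scaler0.
- by rewrite linearZ /= gw2 scaler0.
- by rewrite linearZ.
- by rewrite linearZ /= gw5 scaler0.
Qed.

Lemma root_coord_truncated ty (c := root_coord) :
  iter (depth ty).+1 (bracket f) g = 0 ->
  ((depth ty < 2)%N -> c2 c = 0) /\ ((depth ty < 3)%N -> c3 c = 0 /\ c5 c = 0).
Proof.
have w5_0 : w3 = 0 -> w5 = 0 by rewrite /w5 => ->; rewrite raddf0.
have w3_0 : w2 = 0 -> w3 = 0 by rewrite /w3 => ->; rewrite raddf0.
rewrite /c /=; case: ty => [w2_0|w30|_]; split=> // _.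
- by have -> : w2 = 0 by []; rewrite scaler0.
- by rewrite w5_0 ?w3_0 // scaler0.
by rewrite (w5_0 w30) (w30 : w3 = 0) !scaler0.
Qed.

End SerreRelations.

(** On a root string normalized by divided powers the factorials cancel. *)
Lemma exp_action_chain (V : zmodType) (T : comUnitRingType) (D : nilop V)
    (f : {additive V -> T}) (es : seq V) u :
    (forall n, n.+1%:R \is a @GRing.unit T) ->
    (forall j, (j < size es)%N -> D es`_j = es`_j.+1 *+ j.+1) ->
  exp_action D f u es`_0 = \sum_(j < size es) u ^+ j * f es`_j.
Proof.
move=> T_unit De.
have iterE j : (j <= size es)%N -> iter j D es`_0 = es`_j *+ j`!.
  elim: j => [|j IHj] jn; first by rewrite mulr1n.
  by rewrite iterS IHj ?(ltnW jn) // raddfMn De // -mulrnA factS.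
rewrite (@exp_actionE _ _ D f u _ (size es)); last by rewrite iterE ?nth_default ?mul0rn.
apply: eq_bigr => j _; rewrite iterE; last exact/ltnW.
rewrite raddfMn -[_ *+ _]mulr_natl mulrA; congr (_ * _).
by rewrite /divpow mulrAC mulVr ?mul1r ?fact_unit.
Qed.

Lemma rmorph_intcombE (R S : nzRingType) (f : {rmorphism R -> S}) x y x' y'
    (u v : int) :
  f x = x' -> f y = y' -> f (x *~ u + y *~ v) = u%:~R * x' + v%:~R * y'.
Proof. by move=> <- <-; rewrite rmorphD !raddfMz /= !mulrzl. Qed.

Lemma mcoeff_intcombE (M : conomType) (R : nzRingType) (m : M)
    (x y : {malg R[M]}) cx cy (u v : int) :
  x@_m = cx -> y@_m = cy -> (x *~ u + y *~ v)@_m = cx *~ u + cy *~ v.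
Proof. by move=> <- <-; rewrite mcoeffD !raddfMz. Qed.

(** * Braid relations on the field of fractions *)

Section InvariantForms.
Variables (R : comNzRingType) (d m n : int) (u x y : R).

Lemma invariant_form1 :
  (4 - d)%:~R * (u - m%:~R * x) -
    (((d * m + 2 * n) - (2 * m + n))%:~R * x + (d * m + 2 * n)%:~R * y) =
  (4 - d)%:~R * u - ((2 * m + n)%:~R * x + (d * m + 2 * n)%:~R * y).
Proof. by ring. Qed.

Lemma invariant_form2 :
  (4 - d)%:~R * (u - n%:~R * y) -
    ((2 * m + n)%:~R * x + (d * (2 * m + n) - (d * m + 2 * n))%:~R * y) =
  (4 - d)%:~R * u - ((2 * m + n)%:~R * x + (d * m + 2 * n)%:~R * y).
Proof. by ring. Qed.

End InvariantForms.

Section RankTwoOnK.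
Variables (k : numFieldType) (I : choiceType) (a : I -> I -> int).
Variables (A0 : poissonDomainType k) (phi : I -> A0).
Hypothesis a_gcm : is_gcm a.
Hypothesis phi_neq0 : forall i, phi i != 0.
Hypothesis phi_gen : poisson_generated phi.
Hypothesis phi_serre : forall i j, i != j ->
  iter (absz (- a i j + 1)) (bracket (phi i)) (phi j) = 0.

Local Notation K := (polyFrac A0 I).
Local Notation X := (polyFracX A0).
Local Notation C := (@polyFracC A0 I).

Variable s : I -> {rmorphism K -> K}.
Hypothesis sP : is_weyl_on_K a phi s.

Variables (i1 i2 : I) (ty : rank2).
Hypotheses (i12 : i1 != i2) (a21 : a i2 i1 = -1) (a12 : a i1 i2 = - (depth ty)%:Z).

Definition node (b : bool) : I := if b then i2 else i1.
Definition node_act (b : bool) := s (node b).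
Definition node_lam (b : bool) : K := X (node b).

Lemma weyl_on_K_C i f : s i (C f) = exp_phi phi_gen phi_serre i f.
Proof. by have [_ ->] := sP i. Qed.

Lemma weyl_on_K_X i j : s i (X j) = X j - (a j i)%:~R * X i.
Proof. by have [_ _ ->] := sP i. Qed.

Lemma poisson_intr_eq0 (z : int) : (z%:~R == 0 :> A0) = (z == 0).
Proof.
case: z => [[|n]|n]; rewrite ?eqxx //.
  by rewrite (negPf (poisson_natr_neq0 _ _)).
by rewrite NegzE mulrNz oppr_eq0 (negPf (poisson_natr_neq0 _ _)).
Qed.

(** In characteristic zero, integral combinations of two indeterminates vanish
    only if their coefficients do. *)
Lemma node_lam_free v : linear_form node_lam v = 0 -> v = (0, 0).
Proof.
pose U j : {malg A0[{cmonom I}]} := << ucm j >>.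
have PU j : polyFracP (U j) = X j by rewrite polyFracX.unlock.
rewrite -[linear_form _ _](rmorph_intcombE v.1 v.2 (PU i1) (PU i2)) => /eqP.
rewrite polyFracP_eq0 => /eqP/malgP Uv.
have U0 j l : (U j)@_(ucm l) = (j == l)%:R.
  rewrite mcoeffU1; congr (_%:R); congr (nat_of_bool _).
  apply/eqP/eqP => [|-> //] /(congr1 (fun m : {cmonom I} => m l)).
  by rewrite !cmU eqxx; case: eqP.
case: v Uv => v1 v2 /= Uv.
have := Uv (ucm i2); have := Uv (ucm i1).
rewrite (mcoeff_intcombE _ _ (U0 i1 i1) (U0 i2 i1)).
rewrite (mcoeff_intcombE _ _ (U0 i1 i2) (U0 i2 i2)).
rewrite !mcoeff0 !eqxx eq_sym (negPf i12) !mul0rz addr0 add0r.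
move=> /eqP; rewrite poisson_intr_eq0 => /eqP ->.
by move=> /eqP; rewrite poisson_intr_eq0 => /eqP ->.
Qed.

Let rc := root_coord (phi i1) (phi i2).

Definition node_coord : coord K := coord_map C rc.
Local Notation c := node_coord.

Let serre12 : iter (depth ty).+1 (bracket (phi i1)) (phi i2) = 0.
Proof. by have := phi_serre i12; rewrite a12 opprK; case: (ty). Qed.

Let serre4 : iter 4 (bracket (phi i1)) (phi i2) = 0.
Proof. by apply: iter_nil serre12; case: (ty). Qed.

Let serre2 : iter 2 (bracket (phi i2)) (phi i1) = 0.
Proof. by have := phi_serre (i := i2) (j := i1); rewrite a21 eq_sym; apply. Qed.

Definition node_phi (b : bool) : K := if b then c0 c else cp c.
Definition node_xi (b : bool) : K := node_lam b / node_phi b.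

Lemma node_phiE b : node_phi b = C (phi (node b)).
Proof. by case: b. Qed.

Lemma node_xiE b : node_xi b = lam_phi phi (node b).
Proof. by case: b. Qed.

(** The positive roots fall into strings along each simple root, and on every
    string the reflection is given by [exp_action_chain]. *)
Lemma node_act_coord b :
  coord_map (node_act b) c = coord_exp b (node_xi b) c.
Proof.
have [[t1 t2 t3 t4 t5] [u0 u1 u2 u3 u4]] := root_coord_table serre4 serre2.
have chain es : (forall j, (j < size es)%N ->
      bracket (phi (node b)) es`_j = es`_j.+1 *+ j.+1) ->
    node_act b (C es`_0) = \sum_(j < size es) node_xi b ^+ j * C es`_j.
  move=> De; rewrite /node_act weyl_on_K_C /exp_phi node_xiE.
  apply: exp_action_chain => //; exact: polyFrac_natr_unit.
have fix1 y : bracket (phi (node b)) y = 0 -> node_act b (C y) = C y.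
  move=> Dy; rewrite (chain [:: y]) ?big_ord1 ?expr0 ?mul1r //.
  by case=> // _; rewrite Dy mul0rn.
have [rp r0] : cp rc = phi i1 /\ c0 rc = phi i2 by [].
rewrite /c -/rc; move: chain fix1 t1 t2 t3 t4 t5 u0 u1 u2 u3 u4 rp r0.
rewrite -/rc; case: rc => p z0 z1 z2 z3 z5 /= chain fix1.
move=> t1 t2 t3 t4 t5 u0 u1 u2 u3 u4 -> ->.
case: b chain fix1 => chain fix1 /=.
- rewrite (fix1 (phi i2)) ?bracketff // (fix1 z1) // (fix1 z2) // (fix1 z5) //.
  have -> : node_act true (C (phi i1)) = C (phi i1) - node_xi true * C z1.
    rewrite (chain [:: phi i1; - z1]) => [|[|[|//]] _ /=].
    + by rewrite !big_ord_recl big_ord0 /= mul1r addr0 expr1 rmorphN mulrN.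
    + by rewrite u0 mulr1n.
    by rewrite raddfN /= u1 oppr0 mul0rn.
  have -> // : node_act true (C z3) = C z3 + node_xi true * C z5.
  rewrite (chain [:: z3; z5]) => [|[|[|//]] _ /=].
  + by rewrite !big_ord_recl big_ord0 /= mul1r addr0 expr1.
  + by rewrite u3 mulr1n.
  by rewrite u4 mul0rn.
rewrite (fix1 (phi i1)) ?bracketff // (fix1 z3) // (fix1 z5) //.
set xi := node_xi false.
have -> : node_act false (C (phi i2)) =
    C (phi i2) + xi * C z1 + xi ^+ 2 * C z2 + xi ^+ 3 * C z3.
  rewrite (chain [:: phi i2; z1; z2; z3]) => [|[|[|[|[|//]]]] _ /=] //.
    by rewrite !big_ord_recl big_ord0 /= mul1r addr0 expr1 !addrA.
  by rewrite t4 mul0rn.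
have -> : node_act false (C z1) = C z1 + 2 * xi * C z2 + 3 * xi ^+ 2 * C z3.
  rewrite (chain [:: z1; z2 *+ 2; z3 *+ 3]) => [|[|[|[|//]]] _ /=].
  - rewrite !big_ord_recl big_ord0 /= mul1r addr0 expr1 !rmorphMn.
    rewrite -[C z2 *+ 2]mulr_natl -[C z3 *+ 3]mulr_natl.
    by rewrite addrA [xi * (_ * _)]mulrCA [xi ^+ _ * (_ * _)]mulrCA !mulrA.
  - by rewrite t2.
  - by rewrite raddfMn /= t3 -!mulrnA.
  by rewrite raddfMn /= t4 !mul0rn.
have -> // : node_act false (C z2) = C z2 + 3 * xi * C z3.
rewrite (chain [:: z2; z3 *+ 3]) => [|[|[|//]] _ /=].
- rewrite !big_ord_recl big_ord0 /= mul1r addr0 expr1 rmorphMn.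
  rewrite -[C z3 *+ 3]mulr_natl.
  by rewrite mulrCA mulrA.
- by rewrite t3.
by rewrite raddfMn /= t4 !mul0rn.
Qed.

Let node_phi_neq0 b : node_phi b != 0.
Proof. by rewrite node_phiE Cphi_neq0. Qed.

Let node_coord_truncated : truncated ty c.
Proof.
have [] := root_coord_truncated serre12; rewrite -/rc /truncated /c.
case: rc => p z0 z1 z2 z3 z5; case: (ty) => //= [/(_ isT) -> /(_ isT)[-> ->]|_].
  by rewrite !rmorph0.
by move=> /(_ isT)[-> ->]; rewrite !rmorph0.
Qed.

Let s00 : node_act false (node_lam false) = - node_lam false.
Proof. by have [aii _ _ _] := a_gcm; rewrite /node_act weyl_on_K_X aii /node_lam /=; ring. Qed.

Let s01 : node_act false (node_lam true) = node_lam true + node_lam false.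
Proof. by rewrite /node_act weyl_on_K_X a21 /node_lam /=; ring. Qed.

Let s10 : node_act true (node_lam false) =
  node_lam false + (depth ty)%:R * node_lam true.
Proof. by rewrite /node_act weyl_on_K_X a12 mulrNz mulNr opprK. Qed.

Let s11 : node_act true (node_lam true) = - node_lam true.
Proof. by have [aii _ _ _] := a_gcm; rewrite /node_act weyl_on_K_X aii /node_lam /=; ring. Qed.

Definition node_ad (b : bool) : nilop A0 := ad_phi phi_gen phi_serre (node b).

(** A reflection applied to the product of the exponentials of the following
    letters moves their times and adds its own exponential. *)
Lemma word_act_C w f :
  word_act node_act w (C f) =
  word_exp node_ad C (times node_act node_xi w) f.
Proof.
elim: w => [//|b w IHw]; rewrite times_cons /= IHw.
apply: (@rmorph_word_exp _ node_ad _ _ (node_act b) C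
  (exp_action (node_ad b) C (node_xi b) : {additive A0 -> K})).
  exact: polyFrac_natr_unit.
by move=> g /=; rewrite node_xiE /node_act weyl_on_K_C.
Qed.

(** The Cartan matrix of the pair is invertible: a multiple of any other
    [lambda_j] is the sum of an invariant and a combination of the two. *)
Lemma word_act_X j : word_act node_act (alternating (braid ty)) (X j) = X j.
Proof.
set W := word_act _ _; have [aii _ _ _] := a_gcm.
pose v : int * int := (2 * a j i1 + a j i2, (depth ty)%:Z * a j i1 + 2 * a j i2).
pose det : int := 4 - (depth ty)%:Z.
pose y : K := det%:~R * X j - linear_form node_lam v.
have det_neq0 : det%:~R != 0 :> K.
  by rewrite -(rmorph_int C) polyFracC_eq0 poisson_intr_eq0 /det; case: (ty).
have y_fixed b : node_act b y = y.
  rewrite rmorphB rmorphM rmorph_int (reflect_formE s00 s01 s10 s11) /node_act weyl_on_K_X.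
  rewrite /y /linear_form /reflect_form /det /v /node_lam.
  by case: b; [exact: invariant_form2 | exact: invariant_form1].
have Wy : W y = y by rewrite /W; elim: (alternating _) => //= b w ->.
apply: (mulfI det_neq0); rewrite -[in LHS](rmorph_int W) -rmorphM.
have -> : det%:~R * X j = y + linear_form node_lam v by rewrite subrK.
by rewrite rmorphD Wy (word_act_alternating s00 s01 s10 s11).
Qed.

Lemma word_act_braid : word_act node_act (alternating (braid ty)) =1 id.
Proof.
apply: (polyFrac_rmorph_ext (G := (idfun : {rmorphism K -> K}))); last first.
  exact: word_act_X.
move=> f; rewrite word_act_C.
have rel := bracket_root_coord serre4 serre2.
have [e2_0 e35_0] := root_coord_truncated serre12.
have ad0 y : bracket (0 : A0) y = 0 by rewrite bracketC raddf0 oppr0.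
apply: (@word_exp_trivial _ _ _
  (bracket (c1 rc) : {additive A0 -> A0}) (bracket (c2 rc) : {additive A0 -> A0})
  (bracket (c3 rc) : {additive A0 -> A0}) (bracket (c5 rc) : {additive A0 -> A0})
  _ _ _ _ _ _ _ _ _ _ ty); try by move=> y; have [[]] := rel y.
- exact: polyFrac_natr_neq0.
- by move=> y; have [_ []] := rel y.
- by move=> y; have [_ []] := rel y.
- by move=> y; have [_ []] := rel y.
- by move=> y; have [_ []] := rel y.
- by move=> d y; rewrite (e2_0 d : c2 rc = 0); exact: ad0.
- move=> d y; have [e3 e5] := e35_0 d.
  by rewrite (e3 : c3 rc = 0) (e5 : c5 rc = 0); split; exact: ad0.
exact: (lie_coord_braid s00 s01 s10 s11 node_lam_free node_phi_neq0
          node_coord_truncated node_act_coord).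
Qed.

Lemma node_path_monomial :
  path_monomial ty
    (take (braid ty) (twist node_act node_phi (alternating (braid ty)))) =
  path_monomial ty
    (drop (braid ty) (twist node_act node_phi (alternating (braid ty)))).
Proof.
exact: (path_monomial_braid s00 s01 s10 s11 node_lam_free node_phi_neq0
          node_coord_truncated node_act_coord).
Qed.

End RankTwoOnK.

(** * Alternating words of involutions *)

Section Alternating.
Variables (T : Type) (f g : T -> T).
Hypotheses (ff : involutive f) (gg : involutive g).

Lemma iter_comp_conj m x : iter m (f \o g) (f x) = f (iter m (g \o f) x).
Proof. by elim: m => //= m ->. Qed.

Lemma iter_comp_inv m x : iter m (g \o f) (iter m (f \o g) x) = x.
Proof.
elim: m x => // m IHm x; rewrite iterSr iterS /= ff gg.
exact: IHm.
Qed.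

End Alternating.

Lemma word_act_alternatingE (R : nzRingType) (s : bool -> {rmorphism R -> R}) m x :
  word_act s (alternating m) x = iter m (s false \o s true) x.
Proof. by elim: m => //= m <-. Qed.

(** * Monomials in two tau-functions *)

Section TauMonomials.
Variables (K : fieldType) (L : comUnitRingType) (C : {rmorphism K -> L}).
Variables (s : bool -> {rmorphism K -> K}) (S : bool -> {rmorphism L -> L}).
Variables (ty : rank2) (phi : bool -> K) (t1 t2 r1 r2 : L).
Hypotheses (phi_neq0 : forall b, phi b != 0)
  (t1u : t1 \is a GRing.unit) (t2u : t2 \is a GRing.unit)
  (r1u : r1 \is a GRing.unit) (r2u : r2 \is a GRing.unit).
Hypotheses (SC : forall b x, S b (C x) = C (s b x))
  (Sr1 : forall b, S b r1 = r1) (Sr2 : forall b, S b r2 = r2)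
  (S02 : S false t2 = t2) (S11 : S true t1 = t1)
  (S01 : S false t1 = C (phi false) * t1^-1 * t2 * r1)
  (S12 : S true t2 = C (phi true) * t1 ^+ depth ty * t2^-1 * r2).

Definition texp : Type := int * int * int * int.

(** Reflections send monomials in the two tau-functions [t1] and [t2], and in
    the invariant remainders [r1] and [r2], to such monomials with a factor from
    [K]; following the exponents is enough. *)
Definition tau_monomial (e : texp) : L :=
  let: (x, y, u, v) := e in t1 ^ x * t2 ^ y * r1 ^ u * r2 ^ v.

Definition texp_pairing (b : bool) (e : texp) : int :=
  let: (x, y, u, v) := e in if b then y else x.

Definition texp_reflect d (b : bool) (e : texp) : texp :=
  let: (x, y, u, v) := e in
  if b then (x + d%:Z * y, - y, u, v + y) else (- x, y + x, u + x, v).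

Lemma tau_monomial_reflect b e :
  S b (tau_monomial e) =
  C (phi b ^ texp_pairing b e) * tau_monomial (texp_reflect (depth ty) b e).
Proof.
have Cu i : C (phi i) \is a GRing.unit by rewrite rmorph_unit ?unitfE.
have expM (y z : L) n : y \is a GRing.unit -> z \is a GRing.unit ->
    (y * z) ^ n = y ^ n * z ^ n.
  by move=> yu zu; apply: exprMz_comm => //; apply: mulrC.
case: e => [[[x y] u] v] /=; rewrite !rmorphM !rmorphXz ?unitfE // Sr1 Sr2.
case: b; rewrite /tau_monomial ?S02 ?S11 ?S01 ?S12.
  rewrite !expM ?unitrM ?unitrV ?Cu ?t1u ?t2u ?unitrX //.
  rewrite exprz_inv -[t1 ^+ _]/(t1 ^ (depth ty)%:Z) exprz_exp !exprzDr //.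
  by move: (C _ ^ _) => q; ring.
rewrite !expM ?unitrM ?unitrV ?Cu ?t1u ?t2u //.
rewrite exprz_inv !exprzDr //.
by move: (C _ ^ _) => q; ring.
Qed.

Fixpoint word_exponents d (w : seq bool) (e : texp) : seq int * texp :=
  if w is b :: w' then
    let: (g, e') := word_exponents d w' e in
    (texp_pairing b e' :: g, texp_reflect d b e')
  else ([::], e).

Definition int_monomial (ps : seq K) (gs : seq int) : K :=
  foldr (fun q a => q.1 ^ q.2 * a) 1 (zip ps gs).

Lemma word_act_tau_monomial w e :
  word_act S w (tau_monomial e) =
  C (int_monomial (twist s phi w) (word_exponents (depth ty) w e).1) *
    tau_monomial (word_exponents (depth ty) w e).2.
Proof.
elim: w => [|b w IHw] /=; first by rewrite /int_monomial rmorph1 mul1r.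
rewrite IHw; case: (word_exponents _ w e) => g e' /=.
rewrite rmorphM SC tau_monomial_reflect mulrA -rmorphM; congr (C _ * _).
rewrite /int_monomial /= mulrC; congr (_ * _).
elim: (twist s phi w) g => [|p ps IHp] [|n g] /=; rewrite ?rmorph1 //.
by rewrite rmorphM IHp fmorphXz.
Qed.

(** The factor collected by [t1] along the braid word: the exponents are those
    of the corner monomial, negated on the first half. *)
Lemma word_exponents_alternating :
  word_exponents (depth ty) (alternating (braid ty)) (1, 0, 0, 0) =
  ([seq - e%:Z | e <- path_exponents ty] ++ [seq e%:Z | e <- path_exponents ty],
   (1, 0, 0, 0)).
Proof. by case: (ty); vm_compute. Qed.

Lemma word_act_t1 :
    path_monomial ty (take (braid ty) (twist s phi (alternating (braid ty)))) =
    path_monomial ty (drop (braid ty) (twist s phi (alternating (braid ty)))) ->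
  word_act S (alternating (braid ty)) t1 = t1.
Proof.
set ps := twist _ _ _ => path.
have t1E : t1 = tau_monomial (1, 0, 0, 0) by rewrite /= !expr0z !mulr1.
rewrite [in LHS]t1E word_act_tau_monomial word_exponents_alternating -/ps /=.
rewrite !expr0z !mulr1 expr1z -[X in int_monomial X](cat_take_drop (braid ty)) /int_monomial.
rewrite zip_cat; last first.
  rewrite size_map size_takel ?size_twist; by case: (ty).
have posE us : foldr (fun q a => q.1 ^ q.2 * a) 1
    (zip us [seq e%:Z | e <- path_exponents ty]) = path_monomial ty us.
  by rewrite /path_monomial zip_mapr foldr_map.
have negE us : foldr (fun q a => q.1 ^ q.2 * a) 1
    (zip us [seq - e%:Z | e <- path_exponents ty]) = (path_monomial ty us)^-1.
  rewrite /path_monomial; elim: (path_exponents ty) us => [|e es IHe] [|u us] /=;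
    rewrite ?invr1 // IHe invfM; congr (_ * _).
  by rewrite -exprnN.
rewrite foldr_cat posE -path.
have -> a l : foldr (fun q b => q.1 ^ q.2 * b) a l =
    foldr (fun q b => q.1 ^ q.2 * b) 1 l * a :> K.
  by elim: l => [|q l /= ->]; rewrite ?mul1r // mulrA.
rewrite negE mulVf ?rmorph1 ?mul1r //.
apply/negP => /(implyP (path_monomial_eq0 _ _))/mem_take; apply/negP.
exact: twist_neq0.
Qed.

End TauMonomials.

(** * Braid relations on the tau-functions *)

Section ReflectedMonomials.
Variables (R : comUnitRingType) (c t u r : R).
Hypothesis tu : t \is a GRing.unit.

Lemma mulr_exprN2 : t * t ^ (- 2) = t^-1.
Proof.
by rewrite -[(- 2)%R]/(- 2%:Z) -exprnN expr2 invrM // mulrA divrr // mul1r.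
Qed.

Lemma reflected_monomial1 :
  c * t * (t ^ (- 2) * (u ^ (- -1) * r)) = c * t^-1 * u * r.
Proof. by rewrite -!mulrA; congr (_ * _); rewrite [LHS]mulrA mulr_exprN2. Qed.

Lemma reflected_monomial2 d :
  c * t * (u ^ (- - d%:Z) * (t ^ (- 2) * r)) = c * u ^+ d * t^-1 * r.
Proof.
rewrite -!mulrA; congr (_ * _); rewrite opprK mulrCA; congr (_ * _).
by rewrite [LHS]mulrA mulr_exprN2.
Qed.

Lemma rmorph_fixed_factor (W : {rmorphism R -> R}) :
    c \is a GRing.unit -> r \is a GRing.unit ->
    W c = c -> W t = t -> W r = r ->
  W (c * t^-1 * u * r) = c * t^-1 * u * r -> W u = u.
Proof.
move=> cu ru Wc Wt Wr; rewrite !rmorphM rmorphV // Wc Wt Wr => /(mulIr ru).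
by apply: mulrI; rewrite unitrM cu unitrV.
Qed.

End ReflectedMonomials.

Section TauAction.
Variables (k : numFieldType) (I : choiceType) (a : I -> I -> int).
Variables (A0 : poissonDomainType k) (phi : I -> A0).
Hypothesis a_gcm : is_gcm a.
Hypothesis phi_neq0 : forall i, phi i != 0.
Hypothesis phi_gen : poisson_generated phi.
Hypothesis phi_serre : forall i j, i != j ->
  iter (absz (- a i j + 1)) (bracket (phi i)) (phi j) = 0.

Local Notation K := (polyFrac A0 I).
Local Notation L := (laurent K I).
Local Notation C := (@polyFracC A0 I).
Local Notation X := (polyFracX A0).
Local Notation Q := (@laurentC K I).
Local Notation tau := (@laurentX K I).

Variable s : I -> {rmorphism K -> K}.
Hypothesis sP : is_weyl_on_K a phi s.
Variable S : I -> {rmorphism L -> L}.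
Hypothesis SP : is_tau_extension a phi s S.

Lemma weyl_on_K_involutive i : involutive (s i).
Proof.
exact: (weyl_involutive a_gcm (weyl_on_K_C phi_gen phi_serre sP i)
          (weyl_on_K_X sP i)).
Qed.

Lemma weyl_on_K_phi i : s i (C (phi i)) = C (phi i).
Proof. by rewrite (weyl_on_K_C phi_gen phi_serre sP) exp_phi_phi. Qed.

Lemma tau_ext_C i x : S i (Q x) = Q (s i x).
Proof. by have [] := SP i. Qed.

Lemma tau_ext_tau i j : i != j -> S i (tau j) = tau j.
Proof. by have [_ _ h _] := SP i; apply: h. Qed.

Lemma tau_ext_tau_self i :
  S i (tau i) = Q (C (phi i)) * tau i * tau_root K a i.
Proof. by have [] := SP i. Qed.

Lemma Cphi_unit i : Q (C (phi i)) \is a GRing.unit.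
Proof. by rewrite rmorph_unit // unitfE polyFracC_eq0. Qed.

Lemma tau_ext_involutive i : involutive (S i).
Proof.
apply: (@tau_involutive _ _ a a_gcm s (C \o phi)) => //=.
- by move=> j; rewrite polyFracC_eq0.
- exact: weyl_on_K_phi.
- exact: weyl_on_K_involutive.
- exact: tau_ext_C.
- exact: tau_ext_tau.
exact: tau_ext_tau_self.
Qed.

Lemma tau_ext_braid (i1 i2 : I) ty :
    i1 != i2 -> a i2 i1 = -1 -> a i1 i2 = - (depth ty)%:Z ->
  iter (braid ty) (S i1 \o S i2) =1 id.
Proof.
move=> i12 a21 a12; have i21 : i2 != i1 by rewrite eq_sym.
have [a_diag _ _ _] := a_gcm.
pose Sn b := S (node i1 i2 b).
pose W := word_act Sn (alternating (braid ty)).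
suff W1 : W =1 id by move=> x; rewrite -(word_act_alternatingE Sn) -/W W1.
have uds : uniq [:: i1; i2] by rewrite /= inE i12.
have [r1 [r1u root1 S_r1]] := tau_root_split K a_gcm i1 uds.
have [r2 [r2u root2 S_r2]] := tau_root_split K a_gcm i2 uds.
have S_fix b j : j \notin [:: i1; i2] -> Sn b (tau j) = tau j.
  rewrite !inE negb_or => /andP[j1 j2]; rewrite tau_ext_tau // eq_sym.
  by case: b.
have {}S_r1 b : Sn b r1 = r1 by apply: S_r1; apply: S_fix.
have {}S_r2 b : Sn b r2 = r2 by apply: S_r2; apply: S_fix.
have W_fix x : (forall b, Sn b x = x) -> W x = x.
  by move=> xS; rewrite /W; elim: (alternating _) => //= b w ->.
have WQ x : W (Q x) = Q x.
  rewrite -[in RHS](word_act_braid a_gcm phi_neq0 phi_gen phi_serre sP i12 a21 a12 x).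
  by rewrite /W; elim: (alternating _) => //= b w ->; rewrite tau_ext_C.
have t1u := tau_unit K i1; have t2u := tau_unit K i2.
have S01 : Sn false (tau i1) = Q (C (phi i1)) * (tau i1)^-1 * tau i2 * r1.
  rewrite /Sn -[node i1 i2 false]/i1 tau_ext_tau_self root1 big_cons big_seq1 a_diag a21.
  rewrite -[X in _ * X]mulrA.
  exact: (reflected_monomial1 _ _ _ t1u).
have S12 : Sn true (tau i2) =
    Q (C (phi i2)) * tau i1 ^+ depth ty * (tau i2)^-1 * r2.
  rewrite /Sn -[node i1 i2 true]/i2 tau_ext_tau_self root2 big_cons big_seq1 a_diag a12.
  rewrite -[X in _ * X]mulrA.
  exact: (reflected_monomial2 _ _ _ t2u).
have Wt1 : W (tau i1) = tau i1.
  apply: (word_act_t1 (s := node_act s i1 i2) (phi := node_phi phi i1 i2)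
            (C := Q) (t2 := tau i2) (r1 := r1) (r2 := r2)) => //.
  - by move=> b; rewrite node_phiE polyFracC_eq0.
  - by move=> b x; rewrite tau_ext_C.
  - by rewrite /Sn tau_ext_tau.
  - by rewrite /Sn tau_ext_tau.
  exact: (node_path_monomial a_gcm phi_neq0 phi_gen phi_serre sP i12 a21 a12).
(* [S i1] conjugates the word to its inverse. *)
have WS1 : W (S i1 (tau i1)) = S i1 (tau i1).
  rewrite /W word_act_alternatingE iter_comp_conj; congr (S i1 _).
  rewrite -[in LHS]Wt1 /W word_act_alternatingE.
  by apply: iter_comp_inv; apply: tau_ext_involutive.
have Wt2 : W (tau i2) = tau i2.
  (* The other factors of [S i1 (tau i1)] are already known to be fixed. *)
  have W_S01 := etrans (congr1 W (esym S01)) (etrans WS1 S01).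
  exact: (rmorph_fixed_factor t1u (Cphi_unit i1) r1u (WQ _) Wt1 (W_fix _ S_r1) W_S01).
apply: (laurent_rmorph_ext (H := (idfun : {rmorphism L -> L}))) => [x|j] /=.
  exact: WQ.
have [j12|/S_fix Sj] := boolP (j \in [:: i1; i2]); last first.
  by apply: W_fix => b; exact: Sj.
by move: j12; rewrite !inE => /orP[] /eqP ->.
Qed.

(** The two functions [phi] Poisson commute, so that their exponentials do, and
    each reflection fixes the parameter of the other. *)
Lemma weyl_on_K_commute (i1 i2 : I) x :
    i1 != i2 -> a i1 i2 = 0 -> a i2 i1 = 0 ->
  s i1 (s i2 x) = s i2 (s i1 x).
Proof.
move=> i12 a12 a21; have i21 : i2 != i1 by rewrite eq_sym.
have br12 : bracket (phi i1) (phi i2) = 0.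
  by have := phi_serre i12; rewrite a12.
have br21 : bracket (phi i2) (phi i1) = 0 by rewrite bracketC br12 oppr0.
have fixed i j : bracket (phi i) (phi j) = 0 -> a j i = 0 ->
    s i (lam_phi phi j) = lam_phi phi j.
  move=> br aji; rewrite rmorphM fmorphV (weyl_on_K_X sP) aji mul0r subr0.
  rewrite (weyl_on_K_C phi_gen phi_serre sP) /exp_phi (@exp_actionE _ _ _ _ _ _ 1) //.
  by rewrite big_ord1 divpow0 mul1r.
have compE i j f : bracket (phi i) (phi j) = 0 -> a j i = 0 ->
    s i (s j (C f)) = exp_action (ad_phi phi_gen phi_serre j)
      (exp_phi phi_gen phi_serre i) (lam_phi phi j) f.
  move=> br aji; rewrite [s j _](weyl_on_K_C phi_gen phi_serre sP) /exp_phi.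
  rewrite (rmorph_exp_action _ C (s i) _ _ (polyFrac_natr_unit I A0)) fixed //.
  by apply: exp_action_ext => g /=; rewrite (weyl_on_K_C phi_gen phi_serre sP).
apply: (polyFrac_rmorph_ext (F := (s i1 \o s i2 : {rmorphism K -> K}))
          (G := (s i2 \o s i1 : {rmorphism K -> K}))) => [f|j] /=.
  rewrite !compE //; apply: exp_actionC => y /=.
  by rewrite bracket_bracket br12 [bracket 0 _]bracketC raddf0 oppr0 addr0.
rewrite !(weyl_on_K_X sP) !rmorphB !rmorphM !rmorph_int !(weyl_on_K_X sP) a12 a21 !mul0r !subr0.
by rewrite -!addrA [- _ - _]addrC.
Qed.

Lemma tau_ext_commute (i1 i2 : I) :
    i1 != i2 -> a i1 i2 = 0 -> a i2 i1 = 0 ->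
  iter 2 (S i1 \o S i2) =1 id.
Proof.
move=> i12 a12 a21; have i21 : i2 != i1 by rewrite eq_sym.
suff SS x : S i1 (S i2 x) = S i2 (S i1 x).
  by move=> x; rewrite /= (SS x) tau_ext_involutive tau_ext_involutive.
have swap i j : i != j -> a j i = 0 -> S j (S i (tau i)) = S i (tau i).
  move=> ij aji; have ji : j != i by rewrite eq_sym.
  have uds : uniq [:: i; j] by rewrite /= inE ij.
  have [r [ru rootE Sr]] := tau_root_split K a_gcm i uds.
  have Sjr : S j r = r.
    apply: Sr => l; rewrite !inE negb_or => /andP[_ lj].
    by rewrite tau_ext_tau // eq_sym.
  have sjC : s j (C (phi i)) = C (phi i).
    have br : bracket (phi j) (phi i) = 0.
      have := phi_serre ij; have [_ _ a0 _] := a_gcm; rewrite (a0 i j).2 //=.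
      by move=> br; rewrite bracketC br oppr0.
    rewrite (weyl_on_K_C phi_gen phi_serre sP) /exp_phi (@exp_actionE _ _ _ _ _ _ 1) //.
    by rewrite big_ord1 divpow0 mul1r.
  rewrite tau_ext_tau_self rootE big_cons big_seq1 aji oppr0 expr0z mulr1.
  by rewrite !rmorphM rmorphXz ?tau_unit // tau_ext_C sjC Sjr tau_ext_tau.
apply: (laurent_rmorph_ext (G := (S i1 \o S i2 : {rmorphism L -> L}))
          (H := (S i2 \o S i1 : {rmorphism L -> L}))) => [x'|j] /=.
  by rewrite !tau_ext_C weyl_on_K_commute.
have [<-|j1] := eqVneq i1 j; first by rewrite (tau_ext_tau i21) swap.
have [<-|j2] := eqVneq i2 j; first by rewrite (tau_ext_tau i12) swap.
by rewrite !tau_ext_tau.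
Qed.

End TauAction.

(** A product of two positive integers that is at most 3 has a factor 1. *)
Lemma coxeter_exponent_cases (I : choiceType) (a : I -> I -> int) i j m :
    is_gcm a -> i != j -> coxeter_exponent a i j = Some m ->
  [\/ [/\ m = 2%N, a i j = 0 & a j i = 0],
      exists2 ty, m = braid ty & a j i = -1 /\ a i j = - (depth ty)%:Z
    | exists2 ty, m = braid ty & a i j = -1 /\ a j i = - (depth ty)%:Z].
Proof.
move=> [_ a_le0 a0 _] ij.
have := a_le0 _ _ ij; have := a_le0 j i; rewrite eq_sym => /(_ ij).
have := a0 i j; rewrite /coxeter_exponent.
move: (a i j) (a j i) => x y [xy yx] y_le0 x_le0.
have [x0|x0] := eqVneq x 0.
  by rewrite x0 mul0r => -[<-]; constructor 1; rewrite xy.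
have y0 : y != 0 by apply: contra_neq x0.
have [b yE] : exists b : nat, y = - b.+1%:Z by exists (absz y).-1; lia.
have [c xE] : exists c : nat, x = - c.+1%:Z by exists (absz x).-1; lia.
have -> : x * y = (c.+1 * b.+1)%N by rewrite xE yE mulrNN.
case: b c yE xE => [|b] [|[|[|c]]] yE xE //=.
- by move=> -[<-]; constructor 2; exists A2.
- by move=> -[<-]; constructor 2; exists B2.
- by move=> -[<-]; constructor 2; exists G2.
- case: b yE => [|[|b]] yE //= -[<-]; constructor 3.
    by exists B2.
  by exists G2.
- by rewrite plusE ?mulSn ?addSn !addnS.
- by rewrite plusE ?mulSn ?addSn !addnS.
by rewrite plusE ?mulSn ?addSn !addnS.
Qed.

Lemma weyl_relations_tau (k : numFieldType) (I : choiceType)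
    (a : I -> I -> int) (A0 : poissonDomainType k) (phi : I -> A0)
    (s : I -> {rmorphism polyFrac A0 I -> polyFrac A0 I})
    (S : I -> {rmorphism laurent (polyFrac A0 I) I ->
                         laurent (polyFrac A0 I) I}) :
    is_gcm a -> (forall i, phi i != 0) -> poisson_generated phi ->
    (forall i j, i != j ->
       iter (absz (- a i j + 1)) (bracket (phi i)) (phi j) = 0) ->
    is_weyl_on_K a phi s -> is_tau_extension a phi s S ->
  weyl_relations a S.
Proof.
move=> a_gcm phi_neq0 phi_gen phi_serre sP SP.
have SS := tau_ext_involutive a_gcm phi_neq0 phi_gen phi_serre sP SP.
have braid := tau_ext_braid a_gcm phi_neq0 phi_gen phi_serre sP SP.
split=> [i x|i j ij m]; first exact: SS.
move=> /(coxeter_exponent_cases a_gcm ij)[[-> aij aji]|[ty -> [aji aij]]|].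
- exact: (tau_ext_commute a_gcm phi_neq0 phi_gen phi_serre sP SP ij aij aji).
- exact: braid.
(* The long root comes first: conjugation by [S i] exchanges the two words. *)
move=> [ty -> [aij aji]] x; rewrite -{1}(SS i x) iter_comp_conj.
by rewrite braid 1?eq_sym //; exact: SS.
Qed.

Lemma weyl_tau_exists (k : numFieldType) (I : choiceType)
    (a : I -> I -> int) (A0 : poissonDomainType k) (phi : I -> A0) :
    is_gcm a -> (forall i, phi i != 0) -> poisson_generated phi ->
    (forall i j, i != j ->
       iter (absz (- a i j + 1)) (bracket (phi i)) (phi j) = 0) ->
  exists (s : I -> {rmorphism polyFrac A0 I -> polyFrac A0 I})
         (S : I -> {rmorphism laurent (polyFrac A0 I) I ->
                              laurent (polyFrac A0 I) I}),
    is_weyl_on_K a phi s /\ is_tau_extension a phi s S.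
Proof.
move=> a_gcm phi_neq0 phi_gen phi_serre.
have [s sP] := weyl_on_K_exists a_gcm phi_neq0 phi_gen phi_serre.
have Cphi0 j : polyFracC I (phi j) != 0 by rewrite polyFracC_eq0.
have /choice[S SP] := tau_extension_exists a_gcm Cphi0
  (weyl_on_K_phi phi_gen phi_serre sP) (weyl_on_K_involutive a_gcm phi_gen phi_serre sP).
by exists s, S; split; [exact: sP | exact: SP].
Qed.

Theorem theorem1p2 (R : realType) (I : choiceType) (a : I -> I -> int)
    (A0 : poissonDomainType R[i]) (phi : I -> A0)
    (a_gcm : is_gcm a)
    (phi_neq0 : forall i, phi i != 0)
    (phi_gen : poisson_generated phi)
    (phi_serre : forall i j, i != j ->
       iter (absz (- a i j + 1)) (bracket (phi i)) (phi j) = 0) :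
  (exists (s : I -> {rmorphism polyFrac A0 I -> polyFrac A0 I})
          (S : I -> {rmorphism laurent (polyFrac A0 I) I ->
                               laurent (polyFrac A0 I) I}),
      is_weyl_on_K a phi s /\ is_tau_extension a phi s S) /\
  (forall (s : I -> {rmorphism polyFrac A0 I -> polyFrac A0 I})
          (S : I -> {rmorphism laurent (polyFrac A0 I) I ->
                               laurent (polyFrac A0 I) I}),
      is_weyl_on_K a phi s -> is_tau_extension a phi s S ->
      weyl_relations a S).
Proof.
split; first exact: weyl_tau_exists.
by move=> s S sP SP; apply: weyl_relations_tau sP SP.
Qed.
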